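(* Let $N_0>0$, $\Lambda>1$, $\nu>0$, and $N_n=N_0\Lambda^n$ for $n\ge0$. Suppose that $$\alpha\ge\frac13,\qquad 4\alpha-1>\frac{\log 2}{2\log\Lambda}.$$ Then every non-negative $h\in H_N^\infty$ generates a globally smooth solution of $$\dot u_n+\nu N_n^{2\alpha}u_n=N_{n-1}u_{n-1}^2-N_nu_nu_{n+1}\quad(n\ge0),\qquad u_n(0)=h_n$$ (with the incoming term $N_{n-1}u_{n-1}^2$ defined to be $0$ for $n=0$), and this solution is unique among global non-negative Leray--Hopf solutions with the same initial datum. In particular, these conclusions hold for every $\alpha\ge1/3$ whenever $\Lambda>2^{3/2}$.
   Context: For $s\in\mathbb R$, $H_N^s$ is the space of real sequences $u=(u_n)_{n\ge0}$ with $\|u\|_{H_N^s}^2=\sum_{n\ge0}N_n^{2s}|u_n|^2<\infty$, and $H_N^\infty=\bigcap_{s>0}H_N^s$. ''Non-negative'' means all coordinates are $\ge0$ (at all times, for a solution). A finite-energy solution on an interval $I\subset[0,\infty)$ is an $\ell^2$-valued map $u$ on $I$ whose coordinates $u_n$ belong to $C^1(I)$ and satisfy the equations for every $n\ge0$ (one-sided derivatives at included endpoints), with $u_n(0)=h_n$ for all $n$ if $0\in I$. A finite-energy solution on $[0,T)$ ($0<T\le\infty$; global means $T=\infty$) is a Leray--Hopf solution if $$\|u(t)\|_{\ell^2}^2+2\nu\int_{t_0}^t\|u(\tau)\|_{H_N^\alpha}^2\,\mathrm{d}\tau\le\|u(t_0)\|_{\ell^2}^2$$ holds for $t_0=0$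 and for almost every $t_0\in(0,T)$, and for every $t\in[t_0,T)$. A finite-energy solution is globally smooth if $\sup_{0\le t\le T}\|u(t)\|_{H_N^s}<\infty$ for every $s>0$ and every finite $T>0$. *)

(* Defs.v *)
From HB Require Import structures.
From mathcomp Require Import all_boot all_order all_algebra.
From mathcomp Require Import all_classical all_reals all_analysis.

Set Implicit Arguments.
Unset Strict Implicit.
Unset Printing Implicit Defensive.

Import Order.TTheory GRing.Theory Num.Theory.
Import numFieldNormedType.Exports.

Local Open Scope classical_set_scope.
Local Open Scope ring_scope.

Section DyadicModel.
Context {R : realType}.

Definition freq (N0 Lam : R) (n : nat) : R := N0 * Lam ^+ n.

(* Squared norms and norms take values in [0, +oo], so that "the norm is finite"
   is the membership condition for the corresponding space. *)

Definition ell2_norm_sq (a : nat -> R) : \bar R :=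
  (\sum_(0 <= n <oo) (a n ^+ 2)%:E)%E.

Definition sobolev_norm_sq (N : nat -> R) (s : R) (a : nat -> R) : \bar R :=
  (\sum_(0 <= n <oo) (N n `^ (2 * s) * `|a n| ^+ 2)%:E)%E.

Definition sobolev_norm (N : nat -> R) (s : R) (a : nat -> R) : \bar R :=
  (sobolev_norm_sq N s a `^ 2^-1)%E.

Definition in_sobolev_infty (N : nat -> R) (a : nat -> R) : Prop :=
  forall s : R, 0 < s -> (sobolev_norm_sq N s a < +oo)%E.

(* The derivative is taken relative to [I]: two-sided at interior points of an
   interval, one-sided at the endpoints belonging to it. *)
Definition has_derivative_within (I : set R) (f : R -> R) (t l : R) : Prop :=
  (f s - f t) / (s - t) @[s --> within I t^'] --> l.

Definition is_C1_on (I : set R) (f f' : R -> R) : Prop :=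
  (forall t, I t -> has_derivative_within I f t (f' t)) /\
  {within I, continuous f'}.

Definition incoming (N : nat -> R) (a : nat -> R) (n : nat) : R :=
  if n is m.+1 then N m * a m ^+ 2 else 0.

(* [u t n] is the n-th coordinate at time t; only times in [I] matter, and [I]
   is meant to be an interval contained in [0, +oo). *)
Definition finite_energy_solution (N : nat -> R) (nu alpha : R)
    (h : nat -> R) (I : set R) (u : R -> nat -> R) : Prop :=
  [/\ forall t, I t -> (ell2_norm_sq (u t) < +oo)%E,
      forall n, exists2 du : R -> R,
        is_C1_on I (fun t => u t n) du &
        forall t, I t ->
          du t + nu * N n `^ (2 * alpha) * u t n =
            incoming N (u t) n - N n * u t n * u t n.+1
    & I 0 -> forall n, u 0 n = h n].

Definition lifespan (T : \bar R) : set R :=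
  [set t | 0 <= t /\ (t%:E < T)%E].

Definition energy_inequality (N : nat -> R) (nu alpha : R)
    (u : R -> nat -> R) (t0 t : R) : Prop :=
  (ell2_norm_sq (u t) +
   (2 * nu)%:E *
     \int[lebesgue_measure]_(tau in `[t0, t]) sobolev_norm_sq N alpha (u tau)
   <= ell2_norm_sq (u t0))%E.

Definition leray_hopf_solution (N : nat -> R) (nu alpha : R)
    (h : nat -> R) (T : \bar R) (u : R -> nat -> R) : Prop :=
  [/\ finite_energy_solution N nu alpha h (lifespan T) u,
      forall t, lifespan T t -> energy_inequality N nu alpha u 0 t
    & {ae lebesgue_measure, forall t0 : R, 0 < t0 -> (t0%:E < T)%E ->
        forall t, t0 <= t -> (t%:E < T)%E ->
          energy_inequality N nu alpha u t0 t}].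

Definition globally_smooth (N : nat -> R) (u : R -> nat -> R) : Prop :=
  forall s T : R, 0 < s -> 0 < T ->
    (ereal_sup [set sobolev_norm N s (u t) | t in `[0%R, T]] < +oo)%E.

Definition nonneg_on (I : set R) (u : R -> nat -> R) : Prop :=
  forall t, I t -> forall n, 0 <= u t n.

Definition smooth_and_unique (N : nat -> R) (nu alpha : R) : Prop :=
  forall h : nat -> R, (forall n, 0 <= h n) -> in_sobolev_infty N h ->
  exists u : R -> nat -> R,
    [/\ finite_energy_solution N nu alpha h (lifespan +oo) u,
        globally_smooth N u,
        leray_hopf_solution N nu alpha h +oo u,
        nonneg_on (lifespan +oo) u
      & forall v : R -> nat -> R,
          leray_hopf_solution N nu alpha h +oo v ->
          nonneg_on (lifespan +oo) v ->
          forall t, lifespan +oo t -> forall n, v t n = u t n].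

End DyadicModel.

(* Main.v *)
(** The velocity [v = du/dt] solves the linearized equation, and the weights
    [2^-n] cancel the off-diagonal terms of that equation, so [sum 2^-n v_n^2]
    does not increase and [v_n = O(2^(n/2))] uniformly in time.  In terms of the
    critical amplitude [A_n = N_n^(1 - 2 alpha) u_n] the condition
    [4 alpha - 1 > log 2 / (2 log Lam)] says precisely that such a velocity is
    negligible: at each time the solution is almost stationary.  Since
    [alpha >= 1/3], the flux [A_n^2 A_(n+1)] of a stationary solution decreases
    in [n] by at least a multiple of [A_(n+1)^2], which forces
    [A_n^2 <= C / n] uniformly in time.  Then [N_n u_n^2] is a vanishing fraction
    of the dissipation, and [u_n] decays faster than any power of [N_n].

    These bounds are uniform over the Galerkin truncations.  The cancellation by
    [2^-n] also holds for the difference of two solutions, up to one boundary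
    term that tends to zero as soon as one of the two is smooth: this gives both
    the convergence of the truncations and the uniqueness. *)

Require Import Defs.
From HB Require Import structures.
From mathcomp Require Import all_boot all_order all_algebra.
From mathcomp Require Import all_classical all_reals all_analysis.
From mathcomp Require Import ring lra.

Set Implicit Arguments.
Unset Strict Implicit.
Unset Printing Implicit Defensive.

Import Order.TTheory GRing.Theory Num.Theory.
Import numFieldNormedType.Exports.

Local Open Scope classical_set_scope.
Local Open Scope ring_scope.

(** * Calculus on the half-line: Gronwall bounds, primitives, linear equations *)

Section Evolution.
Context {R : realType}.
Implicit Types (f g df dg : R -> R).

(* Nothing is required for [t < 0], and only right continuity at [0]. *)
Definition evolves f df : Prop :=
  (forall t : R, 0 < t -> is_derive t 1 f (df t)) /\ f x @[x --> 0^'+] --> f 0.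

Lemma evolves_ext f df g dg : f =1 g -> (forall t : R, 0 < t -> df t = dg t) ->
  evolves f df -> evolves g dg.
Proof.
move=> /funext-> e [h1 h2]; split=> // t t0; rewrite -e//; exact: h1.
Qed.

Lemma evolves_cst c : evolves (fun=> c) (fun=> 0).
Proof. by split=> [t _|]; [exact: is_derive_cst|exact: cvg_cst]. Qed.

Lemma evolves_id : evolves id (fun=> 1).
Proof.
split=> [t _|]; first exact: is_derive_id.
exact/cvg_at_right_filter/cvg_id.
Qed.

Lemma evolvesD f df g dg : evolves f df -> evolves g dg ->
  evolves (fun t => f t + g t) (fun t => df t + dg t).
Proof.
move=> [f1 f2] [g1 g2]; split=> [t t0|]; last exact: cvgD.
by apply: is_deriveD; [exact: f1|exact: g1].
Qed.

Lemma evolvesM f df g dg : evolves f df -> evolves g dg ->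
  evolves (fun t => f t * g t) (fun t => df t * g t + f t * dg t).
Proof.
move=> [f1 f2] [g1 g2]; split=> [t t0|]; last exact: cvgM.
have := @is_deriveM _ _ f g t 1 (df t) (dg t) (f1 _ t0) (g1 _ t0).
move=> H; apply: is_derive_eq H _.
by rewrite addrC; congr (_ + _); exact: mulrC.
Qed.

Lemma evolvesZ c f df : evolves f df ->
  evolves (fun t => c * f t) (fun t => c * df t).
Proof.
move=> h; apply: evolves_ext (evolvesM (evolves_cst c) h) => // t _.
by rewrite mul0r add0r.
Qed.

Lemma evolvesN f df : evolves f df -> evolves (fun t => - f t) (fun t => - df t).
Proof.
move=> h; apply: evolves_ext (evolvesZ (-1) h) => t; by rewrite mulN1r.
Qed.

Lemma evolvesB f df g dg : evolves f df -> evolves g dg ->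
  evolves (fun t => f t - g t) (fun t => df t - dg t).
Proof. by move=> hf hg; apply: evolvesD => //; exact: evolvesN. Qed.

Lemma evolves_sum n (f df : nat -> R -> R) :
  (forall k, (k < n)%N -> evolves (f k) (df k)) ->
  evolves (fun t => \sum_(k < n) f k t) (fun t => \sum_(k < n) df k t).
Proof.
elim: n => [_|n IH h].
  by apply: evolves_ext (evolves_cst 0) => t; rewrite big_ord0.
apply: (evolves_ext (f := fun t => \sum_(k < n) f k t + f n t)
    (df := fun t => \sum_(k < n) df k t + df n t)).
- by move=> t; rewrite big_ord_recr.
- by move=> t _; rewrite big_ord_recr.
- apply: evolvesD; last exact: h.
  by apply: IH => k kn; apply: h; exact: ltnW.
Qed.

Lemma evolves_expR c :
  evolves (fun t => expR (c * t)) (fun t => c * expR (c * t)).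
Proof.
split=> [t _|]; last first.
  apply/cvg_at_right_filter/continuous_comp; last exact: continuous_expR.
  exact: mulrl_continuous.
apply: is_derive_eq.
by rewrite /GRing.scale/= mulr1 mulrC.
Qed.

Lemma evolves_derivable f df (t : R) : evolves f df -> 0 < t -> derivable f t 1.
Proof. by move=> [h _] t0; have := h t t0. Qed.

Lemma evolves_derive1 f df (t : R) : evolves f df -> 0 < t -> derive1 f t = df t.
Proof. by move=> [h _] t0; have := h t t0; rewrite derive1E => -[]. Qed.

Lemma evolves_within f df : evolves f df -> {within `[0, +oo[, continuous f}.
Proof.
move=> h; apply: derivable_oy_Rcontinuous_within_itvcy; split; last exact: h.2.
move=> x; rewrite in_itv/= andbT; exact: evolves_derivable h.
Qed.

Lemma evolves_nonincreasing f df : evolves f df ->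
  (forall t : R, 0 < t -> df t <= 0) -> forall s t : R, 0 <= s -> s <= t -> f t <= f s.
Proof.
move=> h hle; apply: ler0_derive1_nincry; last exact: evolves_within h.
- move=> x; rewrite in_itv/= andbT; exact: evolves_derivable h.
- move=> x; rewrite in_itv/= andbT => x0.
  by rewrite (evolves_derive1 h)//; exact: hle.
Qed.

Lemma evolves_le_linear f df c : evolves f df ->
  (forall t : R, 0 < t -> df t <= c) -> forall s t : R, 0 <= s -> s <= t ->
  f t <= f s + c * (t - s).
Proof.
move=> h hle s t s0 st.
have h' := evolvesB h (evolvesZ c evolves_id).
have := evolves_nonincreasing h' _ s0 st => /=.
rewrite mulr1 mulrBr => H.
suff : f t - c * t <= f s - c * s by lra.
by apply: H => x x0; rewrite subr_le0 hle.
Qed.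

Lemma evolves_lipschitz f df c : evolves f df ->
  (forall t : R, 0 < t -> `|df t| <= c) -> forall s t : R, 0 <= s -> 0 <= t ->
  `|f t - f s| <= c * `|t - s|.
Proof.
move=> h hle.
have key s t : 0 <= s -> s <= t -> `|f t - f s| <= c * `|t - s|.
  move=> s0 st.
  have h1 : f t <= f s + c * (t - s).
    by apply: (evolves_le_linear h) => // x /hle; rewrite ler_norml => /andP[].
  have h2 : - f t <= - f s + c * (t - s).
    apply: (evolves_le_linear (evolvesN h)) => // x /hle.
    by rewrite ler_norml => /andP[? ?]; lra.
  rewrite (ger0_norm (_ : 0 <= t - s)) ?subr_ge0// ler_norml; apply/andP; split; lra.
move=> s t s0 t0; have [st|/ltW ts] := leP s t; first exact: key.
by rewrite distrC (distrC t); exact: key.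
Qed.

(* Gronwall: [expR (l * t) * (f t - max (f 0) (c / l))] is nonincreasing. *)
Lemma evolves_le_max f df l c : 0 < l -> evolves f df ->
  (forall t : R, 0 < t -> df t <= - l * f t + c) ->
  forall t : R, 0 <= t -> f t <= Num.max (f 0) (c / l).
Proof.
move=> l0 h hle t t0; set K := Num.max _ _.
have cK : c <= l * K by rewrite mulrC -ler_pdivrMr// le_max lexx orbT.
have h' := evolvesM (evolves_expR l) (evolvesB h (evolves_cst K)).
have H : forall x, 0 < x ->
    l * expR (l * x) * (f x - K) + expR (l * x) * (df x - 0) <= 0.
  move=> x x0; have e0 := expR_ge0 (l * x).
  have -> : l * expR (l * x) * (f x - K) + expR (l * x) * (df x - 0) =
     expR (l * x) * (df x + l * f x - l * K) by ring.
  rewrite mulr_ge0_le0//; have := hle _ x0; lra.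
have := evolves_nonincreasing h' H (lexx 0) t0.
rewrite mulr0 expR0 mul1r => h3.
have f0K : f 0 - K <= 0 by rewrite subr_le0 le_max lexx.
have := le_trans h3 f0K.
by rewrite pmulr_rle0 ?expR_gt0// subr_le0.
Qed.

(** Freezing [f] at [f 0] on negative times gives a function continuous on the whole line, so the
    fundamental theorem of calculus applies at [0] as well. *)
Lemma continuous_max0 f : {within `[0, +oo[, continuous f} ->
  continuous (fun x : R => f (Num.max x 0)).
Proof.
move=> /subspace_continuousP cf x.
have /cf h : `[0, +oo[%classic (Num.max x 0).
  by rewrite /= in_itv/= andbT le_max lexx orbT.
apply: (@cvg_comp _ _ _ (fun y : R => Num.max y 0) f _ _ _ _ h) => A.
rewrite /within/= => hA.
have cmax : {for x, continuous (fun y : R => Num.max y 0)}.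
  by apply: continuous_max; [exact: cvg_id|exact: cvg_cst].
have H : \forall y \near x, Num.max y 0 \in `[0, +oo[ -> A (Num.max y 0) := cmax _ hA.
by apply: filterS H => y; apply; rewrite in_itv/= andbT le_max lexx orbT.
Qed.

Lemma evolves_primitive f c : {within `[0, +oo[, continuous f} ->
  exists F, F 0 = c /\ evolves F f.
Proof.
move=> /continuous_max0; set g := (X in continuous X) => cf.
have intf a b : (@lebesgue_measure R).-integrable `[a, b] (EFin \o g).
  apply: continuous_compact_integrable; first exact: segment_compact.
  exact: continuous_subspaceT.
(* Starting the integral at [-1] puts [0] in the interior, so [G] is differentiable, hence
   continuous, at [0] too. *)
pose G x := (\int[lebesgue_measure]_(t in `[(-1 : R), x]) (g t))%R.
have dG (x : R) : 0 <= x -> is_derive x 1 G (g x).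
  move=> x0.
  have x1 : x < x + 1 by lra.
  have ax : -1 < x by lra.
  have [d e] := @continuous_FTC1_closed _ g (-1) x (x + 1) x1 (intf _ _) ax (cf x).
  split; first exact: d.
  by rewrite -derive1E.
exists (fun x => c + (G x - G 0)); split; first by rewrite subrr addr0.
suff : evolves G f.
  move=> h; apply: evolves_ext (evolvesD (evolves_cst c)
    (evolvesB h (evolves_cst (G 0)))) => //.
  by move=> t _; rewrite add0r subr0.
split=> [t t0|].
  have := dG t (ltW t0).
  by rewrite /g max_l// ltW.
apply: cvg_at_right_filter.
have [d _] := dG 0 (lexx _).
exact/differentiable_continuous/derivable1_diffP.
Qed.

(** Variation of constants, with [F] a primitive of [expR (l * t) * f t]. *)
Lemma evolves_linear_solution f l c : {within `[0, +oo[, continuous f} ->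
  exists y, y 0 = c /\ evolves y (fun t => - l * y t + f t).
Proof.
move=> cf.
have [|F [F0 hF]] := @evolves_primitive (fun t => expR (l * t) * f t) c.
  move=> x; apply: cvgM; last exact: cf.
  exact: (evolves_within (evolves_expR l)).
exists (fun t => expR (- l * t) * F t).
rewrite mulr0 expR0 mul1r; split=> //.
apply: evolves_ext (evolvesM (evolves_expR (- l)) hF) => // t _.
by rewrite [expR (- l * t) * (_ * _)]mulrA -expRD mulNr addNr expR0 mul1r mulrA.
Qed.

End Evolution.


(** * Derivatives relative to the half-line and their stability under limits *)

Section OneSidedDerivatives.
Context {R : realType}.
Implicit Types (f g df dg : R -> R).

Lemma lifespany : lifespan +oo = [set t : R | 0 <= t].
Proof.
by apply/seteqP; split=> t /=; [case|move=> t0; split=> //; exact: ltry].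
Qed.

Lemma has_derivative_within_evolves f df :
  (forall t, lifespan +oo t -> has_derivative_within (lifespan +oo) f t (df t)) ->
  evolves f df.
Proof.
rewrite lifespany /has_derivative_within => h; split=> [t t0|].
  suff H : h^-1 *: (f (h *: 1 + t) - f t) @[h --> 0^'] --> df t.
    split; first by apply/cvg_ex; exists (df t).
    exact/cvg_lim.
  apply/cvgrPdist_le => e e0.
  have /cvgrPdist_le/(_ e e0) := h t (ltW t0).
  rewrite near_withinE => /nbhs_ballP[d /= d0 hd].
  near=> x.
  have x0 : x != 0 by near: x; exact: nbhs_dnbhs_neq.
  have xd : `|x| < d by near: x; exact: dnbhs0_lt.
  have xt : `|x| < t by near: x; exact: dnbhs0_lt.
  have := hd (x + t) _ _ _.
  rewrite addrK mulrC /GRing.scale/= mulr1; apply.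
  - by rewrite /ball/= opprD addrCA subrr addr0 normrN.
  - by rewrite -subr_eq0 addrK.
  - move: xt; rewrite ltr_norml => /andP[xt _]; lra.
have := h 0 (lexx _); set q := (X in X @ _ --> _) => hq.
have hq' : q x @[x --> 0^'+] --> df 0.
  apply: cvg_trans hq; apply: cvg_app => A.
  rewrite /within/= /nbhs/= /at_right/= /within/= => hA.
  near=> x.
  move=> x0.
  have : x != 0 -> 0 <= x -> A x by near: x; exact: hA.
  by apply; [rewrite gt_eqF|exact: ltW].
(* The difference quotient at [0] has a limit; multiplying it by [x - 0] yields right continuity. *)
have h2 : q x * (x - 0) + f 0 @[x --> 0^'+] --> df 0 * (0 - 0) + f 0.
  apply: cvgD; last exact: cvg_cst.
  apply: cvgM => //; apply: cvgB; last exact: cvg_cst.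
  exact/cvg_at_right_filter/cvg_id.
move: h2; rewrite subrr mulr0 add0r; apply: cvg_trans.
apply: near_eq_cvg; near=> x.
have x0 : 0 < x by near: x; exact: nbhs_right_gt.
by rewrite /q divfK ?subrK// subr0 gt_eqF.
Unshelve. all: by end_near. Qed.

Lemma quadratic_has_derivative_within f df K (I : set R) t :
  (forall s, I s -> `|f s - f t - (s - t) * df t| <= K * (s - t) ^+ 2) ->
  has_derivative_within I f t (df t).
Proof.
move=> h; rewrite /has_derivative_within.
have K0 : 0 < `|K| + 1 by rewrite ltr_wpDl.
apply/cvgrPdist_le => e e0.
rewrite near_withinE; near=> s => Is.
have st : s != t by near: s; exact: nbhs_dnbhs_neq.
have st0 : 0 < `|s - t| by rewrite normr_gt0 subr_eq0.
have sd : `|s - t| < e / (`|K| + 1).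
  rewrite distrC; near: s; apply: nbhs_dnbhs.
  by apply: nbhsx_ballx; exact: divr_gt0.
have -> : df t - (f s - f t) / (s - t) = - ((f s - f t - (s - t) * df t) / (s - t)).
  by field; rewrite subr_eq0.
rewrite normrN normrM normfV ler_pdivrMr//.
apply: le_trans (h _ Is) _.
apply: (@le_trans _ _ ((`|K| + 1) * `|s - t| ^+ 2)).
  by rewrite real_normK ?num_real// ler_wpM2r ?sqr_ge0// ler_wpDr// ler_norm.
rewrite expr2 mulrA ler_wpM2r//.
by rewrite mulrC -ler_pdivlMr// ltW.
Unshelve. all: by end_near. Qed.

(** By the mean value theorem the remainder is [(s - t) * (df c - df t)] for some [c] between [s]
    and [t]. *)
Lemma evolves_taylor f df K : evolves f df ->
  (forall s t : R, 0 <= s -> 0 <= t -> `|df s - df t| <= K * `|s - t|) ->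
  forall s t : R, 0 <= s -> 0 <= t ->
  `|f s - f t - (s - t) * df t| <= K * (s - t) ^+ 2.
Proof.
move=> hf hK.
have mvt a b : 0 <= a -> a < b ->
    exists2 c, a < c < b & f b - f a = df c * (b - a).
  move=> a0 ab.
  have hd x : x \in `]a, b[%R -> is_derive x 1 f (df x).
    rewrite in_itv/= => /andP[ax _]; apply: hf.1; exact: le_lt_trans ax.
  have hc : {within `[a, b], continuous f}.
    apply: continuous_subspaceW (evolves_within hf) => x/=.
    by rewrite !in_itv/= => /andP[ax _]; rewrite (le_trans a0 ax).
  have [c + e] := MVT ab hd hc.
  by rewrite in_itv/= => cab; exists c.
have key c s t : 0 <= c -> 0 <= t -> `|c - t| <= `|s - t| ->
    `|(s - t) * (df c - df t)| <= K * (s - t) ^+ 2.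
  move=> c0 t0 cst.
  have K0 : 0 <= K.
    by have := hK 1 0 ler01 (lexx 0); rewrite subr0 normr1 mulr1; exact: le_trans.
  rewrite normrM mulrC -[(s - t) ^+ 2]real_normK ?num_real// expr2 mulrA.
  by rewrite ler_wpM2r// (le_trans (hK _ _ c0 t0))// ler_wpM2l.
move=> s t s0 t0; have [st|ts|->] := ltgtP s t; last first.
- by rewrite !subrr mul0r subr0 normr0 expr0n/= mulr0.
- have [c /andP[tc cs] e] := mvt _ _ t0 ts.
  rewrite e mulrC -mulrBr; apply: key => //; first lra.
  by rewrite !gtr0_norm ?subr_gt0//; lra.
- have [c /andP[sc ct] e] := mvt _ _ s0 st.
  have -> : f s - f t - (s - t) * df t = (s - t) * (df c - df t).
    by rewrite -(opprB (f t)) e; ring.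
  apply: key => //; first lra.
  by rewrite !ltr0_norm ?subr_lt0//; lra.
Qed.

(** The remainder bound of [evolves_taylor] involves only values of the functions and the common
    constant [K], so it survives pointwise limits and makes the limit differentiable, one-sidedly at
    [0]. *)
Lemma evolves_lim (F dF : nat -> R -> R) f df K :
  (forall k, evolves (F k) (dF k)) ->
  (forall k (s t : R), 0 <= s -> 0 <= t ->
    `|dF k s - dF k t| <= K * `|s - t|) ->
  (forall t, 0 <= t -> F k t @[k --> \oo] --> f t) ->
  (forall t, 0 <= t -> dF k t @[k --> \oo] --> df t) ->
  forall t, 0 <= t -> has_derivative_within (lifespan +oo) f t (df t).
Proof.
move=> hF hK hf hdf t t0; apply: (@quadratic_has_derivative_within _ _ K).
rewrite lifespany => s /= s0.
have H : `|F k s - F k t - (s - t) * dF k t| @[k --> \oo] -->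
         `|f s - f t - (s - t) * df t|.
  apply: cvg_norm; apply: cvgB; first by apply: cvgB; exact: hf.
  by apply: cvgM; [exact: cvg_cst|exact: hdf].
apply: (cvgr_to_le H); near=> k; exact: (evolves_taylor (hF k) (hK k)).
Unshelve. all: by end_near. Qed.

End OneSidedDerivatives.


(** * The quadratic vector field, its linearization and the weighted estimates *)

Section Model.
Context {R : realType}.
Variables N lam : nat -> R.
Hypothesis N_ge0 : forall n, 0 <= N n.
Hypothesis lam_gt0 : forall n, 0 < lam n.
Let lam_ge0 n : 0 <= lam n. Proof. exact: ltW. Qed.
Implicit Types (x y w z : nat -> R) (u v : R -> nat -> R).

Definition rhs x n : R := incoming N x n - lam n * x n - N n * x n * x n.+1.

(** The derivative of [rhs] at [w] in the direction [z]. *)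
Definition linearized w z n : R :=
  (if n is m.+1 then 2 * (N m * w m * z m) else 0) - lam n * z n -
  N n * (z n * w n.+1 + w n * z n.+1).

(** Exact because [rhs] is quadratic: the second-order terms cancel at the midpoint. *)
Lemma rhsB x y n :
  rhs x n - rhs y n =
  linearized (fun k => (x k + y k) / 2) (fun k => x k - y k) n.
Proof. by rewrite /rhs /linearized; case: n => [|n] /=; field. Qed.

(* The weights [2^-n] make the two off-diagonal terms cancel. *)
Lemma linearized_weighted_sum w z K : (forall n, (n <= K.+1)%N -> 0 <= w n) ->
  \sum_(n < K.+1) 2^-1 ^+ n * (z n * linearized w z n) <=
  - (2^-1 ^+ K * N K * w K * z K * z K.+1).
Proof.
elim: K => [|K IH] w0.
  rewrite big_ord_recr big_ord0/= expr0 /linearized.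
  have h1 : 0 <= lam 0%N * z 0%N ^+ 2.
    by rewrite !(sqr_ge0, lam_ge0, mulr_ge0).
  have h2 : 0 <= N 0%N * w 1%N * z 0%N ^+ 2.
    by rewrite !(sqr_ge0, w0, mulr_ge0, N_ge0).
  rewrite -subr_ge0; apply: le_trans (addr_ge0 h1 h2) _.
  by rewrite le_eqVlt; apply/orP; left; apply/eqP; ring.
rewrite big_ord_recr/=.
(* The inflow into mode [K.+1] carries the weight [2 * 2^-1 ^+ K.+1 = 2^-1 ^+ K] and cancels the
   boundary term of the induction hypothesis. *)
apply: le_trans (lerD (IH _) (lexx _)) _; first by move=> n nK; apply: w0; exact: leqW.
have e0 : 0 <= 2^-1 ^+ K.+1 :> R by rewrite exprn_ge0.
have h1 : 0 <= 2^-1 ^+ K.+1 * (lam K.+1 * z K.+1 ^+ 2).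
  by rewrite !(sqr_ge0, exprn_ge0, lam_ge0, mulr_ge0, invr_ge0).
have h2 : 0 <= 2^-1 ^+ K.+1 * (N K.+1 * w K.+2 * z K.+1 ^+ 2).
  by rewrite !(sqr_ge0, exprn_ge0, w0, mulr_ge0, N_ge0, invr_ge0).
rewrite -subr_ge0; apply: le_trans (addr_ge0 h1 h2) _.
rewrite le_eqVlt; apply/orP; left; apply/eqP.
rewrite /linearized exprS; by field.
Qed.

Lemma evolves_weighted_square K (Z dZ : nat -> R -> R) :
  (forall n, (n <= K)%N -> evolves (Z n) (dZ n)) ->
  evolves (fun t => \sum_(n < K.+1) 2^-1 ^+ n * Z n t ^+ 2)
          (fun t => 2 * \sum_(n < K.+1) 2^-1 ^+ n * (Z n t * dZ n t)).
Proof.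
move=> h.
have H := @evolves_sum _ K.+1 (fun n t => 2^-1 ^+ n * Z n t ^+ 2)
  (fun n t => 2^-1 ^+ n * (dZ n t * Z n t + Z n t * dZ n t)) _.
apply: evolves_ext (H _) => // [t _|n nK].
  by rewrite big_distrr/=; apply: eq_bigr => n _; ring.
exact/evolvesZ/evolvesM/h/nK/h/nK.
Qed.

Definition solves_upto K u :=
  forall n, (n <= K)%N -> evolves (fun t => u t n) (fun t => rhs (u t) n).

(** By [rhsB] the difference solves the linearized equation at the midpoint, so only the boundary
    term can make the weighted sum grow. It is a multiple of
    [- (u_K^2 - v_K^2) * (u_(K+1) - v_(K+1))], in which only the two mixed products have a positive
    sign. *)
Lemma difference_bound K u v B :
  solves_upto K u -> solves_upto K v ->
  (forall t : R, 0 <= t -> forall n, 0 <= u t n) ->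
  (forall t : R, 0 <= t -> forall n, 0 <= v t n) ->
  (forall n, (n <= K)%N -> u 0 n = v 0 n) ->
  (forall t : R, 0 <= t ->
     N K * (u t K ^+ 2 * v t K.+1 + v t K ^+ 2 * u t K.+1) <= B) ->
  forall t : R, 0 <= t ->
  \sum_(n < K.+1) 2^-1 ^+ n * (u t n - v t n) ^+ 2 <= 2^-1 ^+ K * B * t.
Proof.
move=> hu hv u0 v0 uv hB t t0.
have H : forall n, (n <= K)%N -> evolves (fun t => u t n - v t n)
    (fun t => linearized (fun k => (u t k + v t k) / 2) (fun k => u t k - v t k) n).
  move=> n nK; apply: evolves_ext (evolvesB (hu _ nK) (hv _ nK)) => // s _.
  exact: rhsB.
have L0 : \sum_(n < K.+1) 2^-1 ^+ n * (u 0 n - v 0 n) ^+ 2 = 0.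
  rewrite big1// => n _; rewrite uv; last by rewrite -ltnS.
  by rewrite subrr expr0n/= mulr0.
have := evolves_le_linear (c := 2^-1 ^+ K * B)
  (evolves_weighted_square H) _ (lexx 0) t0.
rewrite subr0 L0 add0r; apply.
  move=> s s0.
  have s0' := ltW s0.
  have L := @linearized_weighted_sum (fun k => (u s k + v s k) / 2)
    (fun k => u s k - v s k) K _.
  apply: le_trans (ler_wpM2l _ (L _)) _ => //.
    by move=> n _; rewrite divr_ge0// addr_ge0 ?u0 ?v0.
  have e0 : 0 <= 2^-1 ^+ K :> R by rewrite exprn_ge0.
  apply: le_trans (ler_wpM2l e0 (hB _ s0')).
  rewrite -subr_ge0.
  have h1 : 0 <= 2^-1 ^+ K * (N K * (u s K ^+ 2 * u s K.+1)).
    by rewrite !(sqr_ge0, exprn_ge0, u0, mulr_ge0, N_ge0, invr_ge0).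
  have h2 : 0 <= 2^-1 ^+ K * (N K * (v s K ^+ 2 * v s K.+1)).
    by rewrite !(sqr_ge0, exprn_ge0, v0, mulr_ge0, N_ge0, invr_ge0).
  apply: le_trans (addr_ge0 h1 h2) _.
  by rewrite le_eqVlt; apply/orP; left; apply/eqP; field.
Qed.

(** Modes beyond [K] are frozen; along a [galerkin_solution] mode [K.+1] is zero, so nothing flows
    out of mode [K]. *)
Definition galerkin K x n : R := if (n <= K)%N then rhs x n else 0.

Lemma evolves_rhs u (du : R -> nat -> R) n :
  (forall k, evolves (fun t => u t k) (fun t => du t k)) ->
  evolves (fun t => rhs (u t) n) (fun t => linearized (u t) (du t) n).
Proof.
move=> h.
have h2 := evolvesB (evolvesN (evolvesZ (lam n) (h n)))
  (evolvesZ (N n) (evolvesM (h n) (h n.+1))).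
case: n h2 => [|n] h2.
  by apply: evolves_ext h2 => t *; rewrite /rhs /linearized/=; ring.
apply: evolves_ext (evolvesD (evolvesZ (N n) (evolvesM (h n) (h n))) h2) => t *;
  by rewrite /rhs /linearized/=; ring.
Qed.

Definition galerkin_solution K u :=
  [/\ forall n, evolves (fun t => u t n) (fun t => galerkin K (u t) n),
      forall t : R, 0 <= t -> forall n, (K < n)%N -> u t n = 0
    & forall t : R, 0 <= t -> forall n, 0 <= u t n].

(** The velocity solves the linearized equation at [u] and vanishes in mode [K.+1], so
    [linearized_weighted_sum] leaves no boundary term. *)
Lemma galerkin_velocity_bound K u : galerkin_solution K u ->
  forall t : R, 0 <= t ->
  \sum_(n < K.+1) 2^-1 ^+ n * rhs (u t) n ^+ 2 <=
  \sum_(n < K.+1) 2^-1 ^+ n * rhs (u 0) n ^+ 2.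
Proof.
move=> [h1 h2 h3] t t0.
have H n : (n <= K)%N -> evolves (fun t => rhs (u t) n)
    (fun t => linearized (u t) (galerkin K (u t)) n).
  by move=> _; exact: evolves_rhs.
apply: (evolves_nonincreasing (evolves_weighted_square H) _ (lexx 0) t0).
move=> s s0; rewrite pmulr_rle0//.
have := @linearized_weighted_sum (u s) (galerkin K (u s)) K (fun n _ => h3 _ (ltW s0) n).
have -> : galerkin K (u s) K.+1 = 0 by rewrite /galerkin ltnn.
rewrite mulr0 oppr0; apply: le_trans.
rewrite le_eqVlt; apply/orP; left; apply/eqP; apply: eq_bigr => n _.
by congr (_ * (_ * _)); rewrite /galerkin -ltnS ltn_ord.
Qed.

(** The transfers between neighbouring modes telescope, leaving the flux out of mode [K]. *)
Lemma rhs_energy x K :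
  \sum_(n < K.+1) x n * rhs x n =
  - \sum_(n < K.+1) lam n * x n ^+ 2 - N K * x K ^+ 2 * x K.+1.
Proof.
elim: K => [|K IH].
  by rewrite !big_ord_recr !big_ord0 /rhs/=; ring.
by rewrite big_ord_recr [in RHS]big_ord_recr/= IH /rhs/=; ring.
Qed.

End Model.


(** * Galerkin truncations: Lipschitz bounds and the invariant box *)

Section Galerkin.
Context {R : realType}.
Variables N lam : nat -> R.
Hypothesis N_ge0 : forall n, 0 <= N n.
Hypothesis lam_gt0 : forall n, 0 < lam n.
Let lam_ge0 n : 0 <= lam n. Proof. exact: ltW. Qed.

(** Bounds row [n] of the derivative at any [w] with [|w| <= C], as a functional of [z] in the
    supremum norm. *)
Definition linearized_norm (C : nat -> R) n : R :=
  (if n is m.+1 then 2 * (N m * C m) else 0) + lam n + N n * (C n.+1 + C n).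

Lemma linearized_le (C w z : nat -> R) d n :
  (forall k, `|w k| <= C k) -> (forall k, `|z k| <= d) ->
  `|linearized N lam w z n| <= linearized_norm C n * d.
Proof.
move=> hw hz; rewrite /linearized /linearized_norm.
have wz i j : `|w i * z j| <= C i * d by rewrite normrM ler_pM.
have wz' i j : `|z j * w i| <= C i * d by rewrite mulrC.
rewrite !mulrDl; apply: le_trans (ler_normB _ _) _; apply: lerD.
  apply: le_trans (ler_normB _ _) _; apply: lerD; last first.
    by rewrite normrM (ger0_norm (lam_ge0 _)) ler_wpM2l.
  case: n => [|n]; first by rewrite normr0 mul0r.
  rewrite -!mulrA !normrM (ger0_norm (N_ge0 _)) (ger0_norm (_ : 0 <= 2))// -normrM.
  by rewrite !ler_wpM2l.
rewrite normrM (ger0_norm (N_ge0 _)) -mulrA ler_wpM2l// mulrDl.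
by apply: le_trans (ler_normD _ _) _; apply: lerD.
Qed.

Lemma geometric_cvg (a : nat -> R) c q : 0 <= q < 1 ->
  (forall k, `|a k.+1 - a k| <= c * q ^+ k) -> cvgn a.
Proof.
move=> /andP[q0 q1] h.
have q1' : 0 < 1 - q by rewrite subr_gt0.
(* [d * q ^+ k] is the sum of all increment bounds from index [k] on, so adding it to [a] gives a
   nonincreasing sequence, bounded below. *)
pose d := c / (1 - q).
have cE : c = d - d * q by rewrite /d; field; rewrite gt_eqF.
pose b k := a k + d * q ^+ k.
have bE : a = b \- (fun k => d * q ^+ k).
  by apply/funext => k /=; rewrite /b addrK.
have g : (fun k => d * q ^+ k) @ \oo --> d * 0.
  apply: cvgM; first exact: cvg_cst.
  by apply: cvg_expr; rewrite ger0_norm.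
rewrite bE; apply: is_cvgB; last by apply/cvg_ex; eexists; exact: g.
have c0 : 0 <= c by have := h 0%N; rewrite expr0 mulr1; exact: le_trans.
have d0 : 0 <= d by rewrite divr_ge0// ltW.
have step k : `|a k.+1 - a k| <= d * q ^+ k - d * q ^+ k.+1.
  by apply: le_trans (h k) _; rewrite {1}cE mulrBl exprS mulrA.
have nb : nonincreasing_seq b.
  apply/nonincreasing_seqP => k; rewrite /b.
  by have := step k; rewrite ler_norml => /andP[_]; lra.
apply: nonincreasing_is_cvgn nb _.
exists (a 0%N - d) => _ [k _ <-].
suff : a 0%N - d <= a k - d * q ^+ k.
  by rewrite /b; have := mulr_ge0 d0 (exprn_ge0 k q0); lra.
elim: k => [|k IH]; first by rewrite expr0 mulr1.
by have := step k; rewrite ler_norml => /andP[+ _]; lra.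
Qed.

Lemma rhs_cvg (x : nat -> nat -> R) y n :
  (forall m, x k m @[k --> \oo] --> y m) ->
  rhs N lam (x k) n @[k --> \oo] --> rhs N lam y n.
Proof.
move=> H; rewrite /rhs; apply: cvgB.
  apply: cvgB; last by apply: cvgM; [exact: cvg_cst|exact: H].
  case: n => [|n] /=; first exact: cvg_cst.
  by apply: cvgM; [exact: cvg_cst|apply: cvgM; exact: H].
by apply: cvgM; [apply: cvgM; [exact: cvg_cst|exact: H]|exact: H].
Qed.

Variable h : nat -> R.
Hypothesis h_ge0 : forall n, 0 <= h n.

(** Without its outflow, mode [n.+1] obeys [u' <= N n * box n ^+ 2 - lam n.+1 * u]; Gronwall keeps
    it below the larger of its datum and the equilibrium of this bound. *)
Fixpoint box n : R :=
  if n is m.+1 then Num.max (h n) (N m * box m ^+ 2 / lam n) else h 0.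

Lemma box_ge_init n : h n <= box n.
Proof. by case: n => [|n]//=; rewrite le_max lexx. Qed.

Lemma box_ge0 n : 0 <= box n.
Proof. exact: le_trans (box_ge_init n). Qed.

Lemma box_inflow n : N n * box n ^+ 2 <= lam n.+1 * box n.+1.
Proof. by rewrite [leRHS]mulrC -ler_pdivrMr//= le_max lexx orbT. Qed.

(** * Picard iteration inside the box, global in time *)

Section Picard.
Variable K : nat.

Let C n : R := if (n <= K)%N then box n else 0.
Let hK n : R := if (n <= K)%N then h n else 0.
Let Cmax : R := \sum_(n < K.+1) box n.
Let kap : R := 1 + \sum_(n < K.+1) (lam n + N n * box n.+1).
Let in_box (x : nat -> R) := forall n, 0 <= x n <= C n.

Let term_le_sum (F : nat -> R) n : (forall n, 0 <= F n) -> (n <= K)%N ->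
  F n <= \sum_(k < K.+1) F k.
Proof.
move=> F0; rewrite -ltnS => nK.
by rewrite (bigD1 (Ordinal nK))//= lerDl sumr_ge0.
Qed.

Let C_ge0 n : 0 <= C n. Proof. by rewrite /C; case: ifP => // _; exact: box_ge0. Qed.

Let C_le_box n : C n <= box n.
Proof. by rewrite /C; case: ifP => // _; exact: box_ge0. Qed.

Let C_le_max n : C n <= Cmax.
Proof.
rewrite /C; case: ifP => nK; first by apply: term_le_sum => //; exact: box_ge0.
by apply: sumr_ge0 => i _; exact: box_ge0.
Qed.

Let kap_gt0 : 0 < kap.
Proof.
by rewrite ltr_pwDl// sumr_ge0// => i _; rewrite addr_ge0// mulr_ge0// box_ge0.
Qed.

Let kap_ge0 : 0 <= kap. Proof. exact: ltW. Qed.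

(* For [kap] this large, [x |-> kap * x + F x] maps the box into [0, kap * C], so
   that the iteration [y' = - kap * y + step x] never leaves the box. *)
Let step x n : R := kap * x n + galerkin N lam K x n.

Let step_in_box x n : in_box x -> 0 <= step x n <= kap * C n.
Proof.
move=> xb; have /andP[x0 xC] := xb n.
rewrite /step /galerkin; have [nK|nK] := leqP n K; last first.
  by move: xC x0; rewrite addr0 /C leqNgt nK/= => ? ?; rewrite mulr_ge0 ?ler_wpM2l// ltW.
have /andP[y0 yC] := xb n.+1.
have k1 : lam n + N n * box n.+1 <= kap.
  apply: le_trans (term_le_sum (F := fun n => lam n + N n * box n.+1) _ nK) _.
    by move=> k; rewrite addr_ge0// mulr_ge0// box_ge0.
  by rewrite lerDr.
have yb : x n.+1 <= box n.+1 := le_trans yC (C_le_box _).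
have Nn := N_ge0 n.
have Nxy : N n * x n * x n.+1 <= N n * box n.+1 * x n.
  by rewrite mulrAC ler_wpM2r// ler_wpM2l.
have Nxy0 : 0 <= N n * x n * x n.+1 by rewrite !mulr_ge0.
have i0 : 0 <= incoming N x n.
  by case: (n) => //= m; rewrite mulr_ge0// sqr_ge0.
have iC : incoming N x n <= lam n * C n.
  move: nK; case: (n) => [|m] mK /=; first by rewrite mulr_ge0.
  rewrite /C mK; apply: le_trans (box_inflow m).
  have /andP[z0 zC] := xb m.
  by rewrite ler_wpM2l// lerXn2r ?nnegrE ?box_ge0// (le_trans zC).
have kx : (lam n + N n * box n.+1) * x n <= kap * x n by rewrite ler_wpM2r.
have kl : lam n <= kap.
  by apply: le_trans k1; rewrite lerDl mulr_ge0// box_ge0.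
have kC : (kap - lam n) * x n <= (kap - lam n) * C n.
  by rewrite ler_wpM2l// subr_ge0.
rewrite /rhs; apply/andP; split; lra.
Qed.

Let in_box_le x k : in_box x -> `|x k| <= box k.
Proof.
by move=> xb; have /andP[x0 xC] := xb k; rewrite ger0_norm// (le_trans xC).
Qed.

Let L : R := kap + \sum_(n < K.+1) linearized_norm box n.

Let ln_ge0 n : 0 <= linearized_norm box n.
Proof.
rewrite /linearized_norm !addr_ge0// ?mulr_ge0 ?addr_ge0 ?box_ge0//.
by case: n => // n; rewrite !mulr_ge0// box_ge0.
Qed.

Let L_gt0 : 0 < L.
Proof. by rewrite ltr_wpDr// sumr_ge0. Qed.

Let step_lipschitz x y d n : in_box x -> in_box y ->
  (forall k, `|x k - y k| <= d) -> `|step x n - step y n| <= L * d.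
Proof.
move=> xb yb hd.
have d0 : 0 <= d by apply: le_trans (hd 0%N).
have -> : step x n - step y n =
  kap * (x n - y n) + (galerkin N lam K x n - galerkin N lam K y n).
  by rewrite /step; ring.
apply: le_trans (ler_normD _ _) _; rewrite [leRHS]mulrDl; apply: lerD.
  by rewrite normrM (gtr0_norm kap_gt0) ler_wpM2l// ltW.
rewrite /galerkin; case: ifP => nK; last first.
  by rewrite subrr normr0 mulr_ge0// sumr_ge0.
rewrite rhsB; apply: le_trans (linearized_le _ (C := box) _ hd) _.
  move=> k; rewrite normrM (ger0_norm (_ : 0 <= 2^-1))//.
  have hx := in_box_le k xb; have hy := in_box_le k yb.
  by have := ler_normD (x k) (y k); lra.
by rewrite ler_wpM2r//; apply: term_le_sum.
Qed.

(** A chosen solution; by [linsolP] the default [fun=> 0] does not occur for continuous [f]. *)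
Let linsol (f : R -> R) (c : R) : R -> R :=
  xget (fun=> 0) [set y | y 0 = c /\ evolves y (fun t => - kap * y t + f t)].

Let linsolP (f : R -> R) c : {within `[0, +oo[, continuous f} ->
  linsol f c 0 = c /\ evolves (linsol f c) (fun t => - kap * linsol f c t + f t).
Proof.
move=> cf; have [y hy] := evolves_linear_solution kap c cf.
exact: (@xgetPex _ (fun=> 0) [set y | y 0 = c /\ evolves y (fun t => - kap * y t + f t)]
  (ex_intro _ y hy)).
Qed.

Fixpoint picard k : R -> nat -> R :=
  if k is j.+1 then fun t n => linsol (fun s => step (picard j s) n) (hK n) t
  else fun t n => hK n.

Let good (u du : R -> nat -> R) :=
  [/\ forall n, evolves (fun t => u t n) (fun t => du t n),
      forall t : R, 0 <= t -> in_box (u t) & forall n, u 0 n = hK n].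

Let step_continuous u du n : good u du ->
  {within `[0, +oo[, continuous (fun s => step (u s) n)}.
Proof.
move=> [hu _ _].
have H : evolves (fun s => step (u s) n) (fun s => kap * du s n +
    if (n <= K)%N then linearized N lam (u s) (du s) n else 0).
  apply: evolvesD; first exact: evolvesZ.
  rewrite /galerkin; case: (n <= K)%N; last exact: evolves_cst.
  exact: evolves_rhs.
exact: evolves_within H.
Qed.

Let dpicard k t n : R :=
  if k is j.+1 then - kap * picard k t n + step (picard j t) n else 0.

Let hK_box : in_box hK.
Proof.
move=> n; rewrite /hK /C; case: ifP => // _; last by rewrite lexx.
by rewrite h_ge0 box_ge_init.
Qed.

Lemma picard_good k : good (picard k) (dpicard k).
Proof.
elim: k => [|k IH].
  by split; [move=> n; exact: evolves_cst|move=> t _; exact: hK_box|].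
have H n := linsolP (hK n) (@step_continuous _ _ n IH).
split; [by move=> n; exact: (H n).2| |by move=> n; exact: (H n).1].
move=> t t0 n; have [H0 H1] := H n; have [_ IHb _] := IH.
have /andP[h0 hC] := hK_box n.
have hs s : 0 < s -> 0 <= step (picard k s) n <= kap * C n.
  by move=> s0; apply: step_in_box; apply: IHb; exact: ltW.
apply/andP; split.
  (* Lower bound: Gronwall for the negative of the iterate, whose forcing is nonpositive. The upper
     bound compares with the equilibrium [C n]. *)
  have hb : forall s, 0 < s ->
      - (- kap * linsol (fun s => step (picard k s) n) (hK n) s + step (picard k s) n)
      <= - kap * (- linsol (fun s => step (picard k s) n) (hK n) s) + 0.
    by move=> s /hs /andP[s0 _]; lra.
  have := evolves_le_max kap_gt0 (evolvesN H1) hb t0.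
  by rewrite H0 mul0r max_r ?oppr_le0// oppr_le0.
have hb : forall s, 0 < s ->
    (- kap * linsol (fun s => step (picard k s) n) (hK n) s + step (picard k s) n)
    <= - kap * (linsol (fun s => step (picard k s) n) (hK n) s) + kap * C n.
  by move=> s /hs /andP[_ s0]; lra.
have := evolves_le_max kap_gt0 H1 hb t0.
by rewrite H0 mulrC mulKf ?max_r// gt_eqF.
Qed.

(** In the supremum norm weighted by [expR (- 2 * L * t)] the iteration contracts by [1/2]: [step]
    costs a factor [L] and integrating the weight gains [1 / (2 * L)]. Hence no restriction on the
    time. *)
Let picard_contract k t n : 0 <= t ->
  `|picard k.+1 t n - picard k t n| <= Cmax * 2^-1 ^+ k * expR (2 * L * t).
Proof.
elim: k t n => [|k IH] t n t0.
  have [_ /(_ t t0 n)/andP[a0 aC] _] := picard_good 1.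
  have [_ /(_ t t0 n)/andP[b0 bC] _] := picard_good 0.
  rewrite expr0 mulr1 (@le_trans _ _ Cmax)//.
    by rewrite ler_norml; have := C_le_max n; lra.
  rewrite ler_peMr//; first exact: le_trans (C_le_max 0%N).
  by rewrite -expR0 ler_expR !mulr_ge0// ltW.
set c := Cmax * 2^-1 ^+ k.+1.
have [h1 b1 i1] := picard_good k.+1; have [h2 b2 i2] := picard_good k.+2.
have [_ b0 _] := picard_good k.
have hd := evolvesB (h2 n) (h1 n).
have he := evolvesZ c (evolves_expR (2 * L)).
have c0 : 0 <= c.
  by rewrite mulr_ge0 ?exprn_ge0// (le_trans (C_ge0 0%N) (C_le_max 0%N)).
have st s : 0 < s ->
    `|step (picard k.+1 s) n - step (picard k s) n| <= 2 * L * (c * expR (2 * L * s)).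
  move=> s0; have s0' := ltW s0.
  apply: le_trans (step_lipschitz n (b1 _ s0') (b0 _ s0') (fun m => IH s m s0')) _.
  by rewrite /c exprS le_eqVlt; apply/orP; left; apply/eqP; field.
(* [c * expR (2 * L * t)] is a supersolution; the key is applied to the difference of iterates and
   to its negative. *)
have key (g dg : R -> R) : evolves g dg -> g 0 = 0 ->
    (forall s, 0 < s -> dg s <= - kap * g s + 2 * L * (c * expR (2 * L * s))) ->
    g t <= c * expR (2 * L * t).
  move=> hg g0 hdg.
  have := evolves_le_max kap_gt0 (evolvesB hg he) (c := 0) _ t0.
  rewrite g0 mul0r mulr0 expR0 mulr1 sub0r max_r ?oppr_le0// subr_le0; apply.
  move=> s s0; have := hdg s s0.
  have k0 := mulr_ge0 (ltW kap_gt0) (mulr_ge0 c0 (expR_ge0 (2 * L * s))).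
  lra.
rewrite ler_norml; apply/andP; split.
  rewrite lerNl; apply: (key _ _ (evolvesN hd)); first by rewrite i1 i2 subrr oppr0.
  move=> s s0; have := st s s0; rewrite ler_norml /dpicard => /andP[? ?]; lra.
apply: (key _ _ hd); first by rewrite i1 i2 subrr.
move=> s s0; have := st s s0; rewrite ler_norml /dpicard => /andP[? ?]; lra.
Qed.

Let picard_cvg t n : 0 <= t ->
  picard k t n @[k --> \oo] --> limn (fun k => picard k t n).
Proof.
move=> t0; apply: (@geometric_cvg _ (Cmax * expR (2 * L * t)) 2^-1) => [|k].
  by apply/andP; split; lra.
by apply: le_trans (picard_contract k n t0) _; rewrite mulrAC.
Qed.

Let dpicard_le k t n : 0 <= t -> `|dpicard k t n| <= kap * Cmax.
Proof.
move=> t0; have kC : kap * C n <= kap * Cmax by rewrite ler_wpM2l.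
case: k => [|k].
  by rewrite normr0 (le_trans _ kC)// mulr_ge0.
have [_ /(_ t t0) b _] := picard_good k.
have [_ /(_ t t0 n)/andP[a0 aC] _] := picard_good k.+1.
have /andP[s0 sC] := step_in_box n b.
have ka0 := mulr_ge0 (ltW kap_gt0) a0.
have kaC : kap * picard k.+1 t n <= kap * C n by rewrite ler_wpM2l.
rewrite /dpicard ler_norml; lra.
Qed.

Let picard_lipschitz k s t n : 0 <= s -> 0 <= t ->
  `|picard k s n - picard k t n| <= kap * Cmax * `|s - t|.
Proof.
move=> s0 t0; have [hk _ _] := picard_good k.
by apply: (evolves_lipschitz (hk n)) => // x /ltW/dpicard_le.
Qed.

Lemma galerkin_exists : exists u,
  [/\ galerkin_solution N lam K u,
      forall n, (n <= K)%N -> u 0 n = h n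
    & forall t : R, 0 <= t -> forall n, u t n <= box n].
Proof.
pose u t n := limn (fun k => picard k t n).
have ucvg t n : 0 <= t -> picard k t n @[k --> \oo] --> u t n := @picard_cvg t n.
have ub t n : 0 <= t -> 0 <= u t n <= C n.
  move=> t0; apply/andP; split.
    apply: (cvgr_to_ge (ucvg t n t0)); near=> k.
    by have [_ /(_ t t0 n)/andP[]] := picard_good k.
  apply: (cvgr_to_le (ucvg t n t0)); near=> k.
  by have [_ /(_ t t0 n)/andP[]] := picard_good k.
exists u; split; first split.
- move=> n; apply: has_derivative_within_evolves => t.
  rewrite {1}lifespany/=; move: t.
  apply: (@evolves_lim _ (fun k t => picard k.+1 t n) (fun k t => dpicard k.+1 t n)
    (fun t => u t n) (fun t => galerkin N lam K (u t) n)
    (kap * (kap * Cmax) + L * (kap * Cmax))).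
  + by move=> k; have [] := picard_good k.+1.
  + move=> k s t s0 t0.
    have -> : dpicard k.+1 s n - dpicard k.+1 t n =
      - (kap * (picard k.+1 s n - picard k.+1 t n)) +
      (step (picard k s) n - step (picard k t) n) by rewrite /dpicard; ring.
    apply: le_trans (ler_normD _ _) _.
    rewrite [leRHS](mulrDl (kap * (kap * Cmax))); apply: lerD.
      rewrite normrN normrM (gtr0_norm kap_gt0) -[leRHS]mulrA.
      by rewrite ler_wpM2l// picard_lipschitz.
    have [_ b _] := picard_good k.
    rewrite -mulrA; apply: step_lipschitz; [exact: b|exact: b|].
    by move=> m; exact: picard_lipschitz.
  + move=> t t0; have H := ucvg t n t0; rewrite -(cvg_shiftS _) in H.
    exact: H.
  + move=> t t0; rewrite /dpicard.
    (* In the limit the damping [- kap * u] cancels the shift inside [step], leaving the Galerkin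
       field. *)
    have -> : galerkin N lam K (u t) n = - kap * u t n + step (u t) n.
      by rewrite /step; ring.
    apply: cvgD.
      apply: cvgM; first exact: cvg_cst.
      have H := ucvg t n t0; rewrite -(cvg_shiftS _) in H; exact: H.
    apply: cvgD.
      by apply: cvgM; [exact: cvg_cst|exact: ucvg].
    rewrite /galerkin; case: (n <= K)%N; last exact: cvg_cst.
    by apply: rhs_cvg => m; exact: ucvg.
- move=> t t0 n nK; apply/eqP; rewrite eq_le.
  by have := ub t n t0; rewrite /C leqNgt nK/= => /andP[-> ->].
- by move=> t t0 n; have /andP[] := ub t n t0.
- move=> n nK.
  have -> : u 0 n = hK n; last by rewrite /hK nK.
  rewrite /u; have -> : (fun k => picard k 0 n) = cst (hK n).
    by apply/funext => k; have [_ _ ->] := picard_good k.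
  exact: lim_cst.
- by move=> t t0 n; have /andP[_ /le_trans] := ub t n t0; apply.
Unshelve. all: by end_near. Qed.

End Picard.
End Galerkin.


(** * Real sequences: decay of an almost conserved flux, eventual contraction *)

Section Sequences.
Context {R : realType}.

(* With [H n = G n + c * r ^+ n / (1 - r)], the hypothesis says that [H] is
   nonincreasing and that [d * a n.+1 ^+ 2 <= H n - H n.+1]; hence [a] is square
   summable, so [G] and [H] are summable, and [n * H n] is bounded. *)
Lemma flux_decay (p r c d g0 : R) :
  0 < p -> 0 < r < 1 -> 0 <= c -> 0 < d -> exists Q, 0 <= Q /\
  forall a G : nat -> R, (forall n, 0 <= a n) -> 0 <= G 0%N <= g0 ->
    (forall n, G n.+1 + d * a n.+1 ^+ 2 <= G n + c * r ^+ n) ->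
    (forall n, G n = p * a n ^+ 2 * a n.+1) ->
    forall n, a n.+1 ^+ 2 * n.+1%:R <= Q.
Proof.
move=> p0 /andP[r0 r1] c0 d0.
pose h0 := `|g0| + c / (1 - r).
(* [s] bounds every [a n.+1], since [a ^+ 2 <= h0 / d] gives [a <= 1 + h0 / d]; [Q0] will bound
   [n%:R * H n]. *)
pose s := 1 + h0 / d.
pose Q0 := p * s / d * h0 + c / (1 - r) ^+ 2.
have r1' : 0 < 1 - r by rewrite subr_gt0.
have h00 : 0 <= h0 by rewrite addr_ge0// divr_ge0// ltW.
have s0 : 0 < s by rewrite ltr_pwDl// divr_ge0// ltW.
have ps0 : 0 <= p * s / d by rewrite divr_ge0 ?mulr_ge0// ltW.
exists ((Q0 + h0) / d); split.
  apply: divr_ge0; last exact: ltW.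
  apply: addr_ge0 => //; apply: addr_ge0; first exact: mulr_ge0.
  by rewrite divr_ge0// exprn_ge0// ltW.
move=> a G a0 /andP[G00 G0g] hG GE.
have rn0 n : 0 <= r ^+ n by rewrite exprn_ge0// ltW.
have G0 n : 0 <= G n by rewrite GE !mulr_ge0 ?exprn_ge0// ltW.
pose H n := G n + c * r ^+ n / (1 - r).
have H0 n : 0 <= H n by rewrite addr_ge0// divr_ge0 ?mulr_ge0// ltW.
have HS n : H n.+1 + d * a n.+1 ^+ 2 <= H n.
  have -> : H n = G n + c * r ^+ n + c * r ^+ n.+1 / (1 - r).
    by rewrite /H exprS; field; rewrite gt_eqF.
  by rewrite /H; have := hG n; lra.
have d2 n : 0 <= d * a n ^+ 2 by rewrite mulr_ge0 ?sqr_ge0// ltW.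
have Hh n : H n <= h0.
  elim: n => [|n IH]; last by have := HS n; have := d2 n.+1; lra.
  by rewrite /H /h0 expr0 mulr1; have := ler_norm g0; lra.
have as' n : a n.+1 <= s.
  have : a n.+1 ^+ 2 <= h0 / d.
    by rewrite ler_pdivlMr// mulrC; have := HS n; have := H0 n.+1; have := Hh n; lra.
  by rewrite /s; have := a0 n.+1; nra.
(* Each [H k.+1] is a flux, at most [p * s / d * (H k - H k.+1)], plus a geometric tail, at most
   [c * r ^+ k / (1 - r)]. Both bounds are summed here over [k < n], and monotonicity of [H] turns
   the sum of the [H k.+1] into [n%:R * H n]. *)
have key n : n%:R * H n <= p * s / d * (h0 - H n) + c * (1 - r ^+ n) / (1 - r) ^+ 2.
  elim: n => [|n IH].
    rewrite mul0r expr0 subrr mulr0 mul0r addr0 mulr_ge0// subr_ge0; exact: Hh.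
  have h1 : n%:R * H n.+1 <= n%:R * H n.
    by rewrite ler_wpM2l ?ler0n//; have := HS n; have := d2 n.+1; lra.
  have h2 : G n.+1 <= p * s / d * (H n - H n.+1).
    rewrite GE; apply: (@le_trans _ _ (p * s / d * (d * a n.+1 ^+ 2))).
      have -> : p * s / d * (d * a n.+1 ^+ 2) = p * a n.+1 ^+ 2 * s.
        by field; rewrite gt_eqF.
      by rewrite ler_wpM2l// mulr_ge0 ?sqr_ge0// ltW.
    by rewrite ler_wpM2l//; have := HS n; lra.
  have h3 : c * (1 - r ^+ n.+1) / (1 - r) ^+ 2 =
      c * (1 - r ^+ n) / (1 - r) ^+ 2 + c * r ^+ n / (1 - r).
    by rewrite exprS; field; rewrite gt_eqF.
  have h4 : c * r ^+ n.+1 / (1 - r) <= c * r ^+ n / (1 - r).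
    rewrite ler_wpM2r ?invr_ge0 ?(ltW r1')// ler_wpM2l// exprS.
    by rewrite ler_piMl// ltW.
  have HE : H n.+1 = G n.+1 + c * r ^+ n.+1 / (1 - r) by [].
  rewrite -natr1 h3; move: h1 h2 h4 IH HE.
  move: (H n.+1) (H n) (G n.+1) (c * r ^+ n.+1 / (1 - r)) => x y z w h1 h2 h4 IH HE.
  rewrite mulrDl mul1r; move: IH h2; rewrite !mulrBr; lra.
move=> n.
have h1 : n%:R * H n <= Q0.
  apply: le_trans (key n) _; rewrite /Q0; apply: lerD.
    by rewrite ler_wpM2l//; have := H0 n; lra.
  rewrite ler_wpM2r ?invr_ge0 ?exprn_ge0 ?(ltW r1')//.
  by rewrite ler_piMr//; have := rn0 n; lra.
rewrite ler_pdivlMr// -natr1.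
have h2 := HS n; have h3 := H0 n.+1; have h4 := Hh n.
have h5 : n%:R * (d * a n.+1 ^+ 2) <= n%:R * H n.
  by rewrite ler_wpM2l ?ler0n//; lra.
lra.
Qed.

(** Once [q n <= 1], the recursion cannot raise a bound that exceeds [H]; the finitely many earlier
    terms enter through their sum. *)
Lemma eventually_contracting_bounded (y q : nat -> R) (H : R) :
  (forall n, 0 <= y n) -> 0 <= H ->
  (forall n, y n.+1 <= Num.max H (q n * y n)) ->
  (\forall n \near \oo, q n <= 1) -> exists B, forall n, y n <= B.
Proof.
move=> y0 H0 hy [m _ hq].
pose B := H + \sum_(k < m.+1) y k.
exists B => n.
have yB k : (k <= m)%N -> y k <= B.
  rewrite -ltnS => km; rewrite /B (bigD1 (Ordinal km))//=.
  by rewrite addrCA lerDl addr_ge0// sumr_ge0.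
have [/yB//|/ltnW mn] := leqP n m.
rewrite -(subnK mn); elim: (n - m)%N => [|k IH]; first exact: yB.
rewrite addSn; apply: le_trans (hy _) _; rewrite ge_max; apply/andP; split.
  by rewrite lerDl sumr_ge0.
apply: le_trans IH; rewrite ler_piMl// hq//=; exact: leq_addl.
Qed.

End Sequences.


(** * Powers of the frequencies and rapid decay *)

Section Freq.
Context {R : realType}.
Variables N0 Lam : R.
Hypothesis N0_gt0 : 0 < N0.
Hypothesis Lam_gt1 : 1 < Lam.
Local Notation N := (freq N0 Lam).

Let Lam_gt0 : 0 < Lam. Proof. exact: lt_trans Lam_gt1. Qed.

Lemma freq_gt0 n : 0 < N n.
Proof. by rewrite mulr_gt0// exprn_gt0. Qed.

Lemma freq_powR_gt0 n e : 0 < N n `^ e.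
Proof. exact/powR_gt0/freq_gt0. Qed.

Lemma freq_powRD n e f : N n `^ (e + f) = N n `^ e * N n `^ f.
Proof. by apply: powRD; rewrite (gt_eqF (freq_gt0 n)) implybT. Qed.

Lemma freq_powR1 n : N n `^ 1 = N n.
Proof. by rewrite powRr1// ltW// freq_gt0. Qed.

Lemma freq_powRS n e : N n.+1 `^ e = Lam `^ e * N n `^ e.
Proof.
rewrite -powRM ?(ltW Lam_gt0) ?(ltW (freq_gt0 n))//.
by rewrite /freq exprS mulrCA.
Qed.

Lemma freq_powR n e : N n `^ e = N0 `^ e * (Lam `^ e) ^+ n.
Proof.
elim: n => [|n IH]; first by rewrite /freq !expr0 !mulr1.
by rewrite freq_powRS IH exprS mulrCA.
Qed.

Lemma powR_sqr (x e : R) : (x `^ e) ^+ 2 = x `^ (2 * e).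
Proof. by rewrite mulrC powRrM powR_mulrn// powR_ge0. Qed.

Lemma sobolev_infty_bounded h s : 0 < s -> in_sobolev_infty N h ->
  exists B, forall n, N n `^ s * `|h n| <= B.
Proof.
move=> s0 /(_ s s0); rewrite /sobolev_norm_sq => hs.
set S := (X in (X < _)%E) in hs.
have t0 n : (0 <= (N n `^ (2 * s) * `|h n| ^+ 2)%:E)%E.
  by rewrite lee_fin mulr_ge0 ?powR_ge0 ?exprn_ge0.
have S0 : (0 <= S)%E by apply: nneseries_ge0.
have SE : S = (fine S)%:E by rewrite fineK// ge0_fin_numE.
(* [y ^+ 2 <= S] gives [y <= 1 + S], which avoids a square root. *)
exists (1 + fine S) => n.
have : ((N n `^ (2 * s) * `|h n| ^+ 2)%:E <= S)%E.
  apply: le_trans (nneseries_lim_ge n.+1 _); last by move=> *; exact: t0.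
  rewrite big_nat_recr//= leeDr// sume_ge0// => i _; exact: t0.
rewrite SE lee_fin -powR_sqr -exprMn.
have : 0 <= N n `^ s * `|h n| by rewrite mulr_ge0 ?powR_ge0.
by set y := _ * _ => y0 hy; nra.
Qed.

(** For [s <= 0] the exponent is split as [(s - 1) + 1], and the powers with exponent [s - 1] are
    largest at frequency [N0]. *)
Lemma rapid_decay_bound (x : nat -> R) s : (forall n, 0 <= x n) ->
  (forall s, 0 < s -> exists B, forall n, N n `^ s * x n <= B) ->
  exists B, 0 <= B /\ forall n, N n `^ s * x n <= B.
Proof.
move=> x0 hx; have [s0|s0] := ltP 0 s.
  have [B hB] := hx s s0; exists B; split=> //.
  by apply: le_trans (hB 0%N); rewrite mulr_ge0 ?powR_ge0.
have [B hB] := hx 1 ltr01.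
have B0 : 0 <= B by apply: le_trans (hB 0%N); rewrite mulr_ge0 ?powR_ge0.
exists (N0 `^ (s - 1) * B); split; first by rewrite mulr_ge0 ?powR_ge0.
move=> n; rewrite -[s](subrK 1) freq_powRD -mulrA addrK.
apply: ler_pM; rewrite ?powR_ge0 ?mulr_ge0 ?powR_ge0//.
rewrite freq_powR ler_piMr ?powR_ge0//.
rewrite exprn_ile1 ?powR_ge0//.
by rewrite -[leRHS](powRr0 Lam) ler_powR ?(ltW Lam_gt1)//; lra.
Qed.

End Freq.

(** * Almost conservation of the flux and decay of the amplitudes *)

Section Decay.
Context {R : realType}.
Variables N0 Lam nu alpha : R.
Hypothesis N0_gt0 : 0 < N0.
Hypothesis Lam_gt1 : 1 < Lam.
Hypothesis nu_gt0 : 0 < nu.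
Hypothesis alpha_ge : 3^-1 <= alpha.
Hypothesis ratio_lt1 : 2 * Lam `^ (2 - 8 * alpha) < 1.
Local Notation N := (freq N0 Lam).

Definition damping n : R := nu * N n `^ (2 * alpha).
Local Notation lam := damping.

Lemma damping_gt0 n : 0 < lam n.
Proof. by rewrite mulr_gt0// freq_powR_gt0. Qed.

Let N_ge0 n : 0 <= N n. Proof. exact/ltW/freq_gt0. Qed.

Let Lam_gt0 : 0 < Lam. Proof. exact: lt_trans Lam_gt1. Qed.

(* The dimensionless amplitude [N_n^(1 - 2 alpha) u_n]: the nonlinear term is
   comparable with the dissipation exactly when it is of order one. *)
Definition amplitude (x : nat -> R) n : R := N n `^ (1 - 2 * alpha) * x n.

(** The energy flux [N n * x n ^+ 2 * x n.+1] rescaled by the power [2 - 6 * alpha] of [N n], which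
    makes it cubic in the amplitudes ([fluxE]). *)
Definition flux (x : nat -> R) n : R :=
  N n `^ (3 - 6 * alpha) * x n ^+ 2 * x n.+1.

(* Quasi-stationarity: a velocity [rhs x n.+1 = O(2^(n/2))] is negligible with
   respect to the terms of the equation at critical amplitude, so that
   multiplying the equation by [N_n^(2 - 6 alpha) x_n] gives an almost
   conserved flux. *)
Lemma flux_step (x : nat -> R) V n : (forall n, 0 <= x n) ->
  2^-1 ^+ n.+1 * rhs N lam x n.+1 ^+ 2 <= V ->
  flux x n.+1 + nu / 2 * amplitude x n.+1 ^+ 2 <=
  flux x n + V * (2 * Lam `^ (2 - 8 * alpha)) * N0 `^ (2 - 8 * alpha) / (2 * nu) *
    (2 * Lam `^ (2 - 8 * alpha)) ^+ n.
Proof.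
move=> x0 hV.
set v := rhs _ _ _ _ in hV.
set a := amplitude x n.+1.
have e1 : N n.+1 `^ (2 - 6 * alpha) * x n.+1 = N n.+1 `^ (1 - 4 * alpha) * a.
  rewrite /a /amplitude mulrA -freq_powRD//; congr (_ `^ _ * _); lra.
have e2 : N n.+1 `^ (2 - 6 * alpha) * lam n.+1 * x n.+1 ^+ 2 = nu * a ^+ 2.
  rewrite /a /amplitude exprMn powR_sqr /damping.
  have -> : N n.+1 `^ (2 * (1 - 2 * alpha)) =
      N n.+1 `^ (2 - 6 * alpha) * N n.+1 `^ (2 * alpha).
    by rewrite -freq_powRD//; congr (_ `^ _); lra.
  ring.
have e3 : N n.+1 `^ (2 - 6 * alpha) * N n.+1 = N n.+1 `^ (3 - 6 * alpha).
  have -> : 3 - 6 * alpha = 2 - 6 * alpha + 1 by ring.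
  by rewrite (freq_powRD N0_gt0 Lam_gt1 _ (2 - 6 * alpha) 1) freq_powR1.
have e4 : N n `^ (2 - 6 * alpha) * N n = N n `^ (3 - 6 * alpha).
  have -> : 3 - 6 * alpha = 2 - 6 * alpha + 1 by ring.
  by rewrite (freq_powRD N0_gt0 Lam_gt1 _ (2 - 6 * alpha) 1) freq_powR1.
(* Here [alpha >= 1/3] enters: [Lam] to the power [2 - 6 * alpha] is at most one, so shifting the
   weight by one mode does not increase the flux. *)
have e5 : N n.+1 `^ (2 - 6 * alpha) * N n <= N n `^ (3 - 6 * alpha).
  rewrite -e4 ler_wpM2r// freq_powRS// ler_piMl ?powR_ge0//.
  rewrite -[leRHS](powRr0 Lam) ler_powR ?(ltW Lam_gt1)//.
  by have := alpha_ge; rewrite -[3^-1]mulr1 ler_pdivrMl//; lra.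
(* The weighted velocity bound is geometric, with the ratio that [ratio_lt1] makes smaller than
   one. *)
have e6 : N n.+1 `^ (2 - 8 * alpha) * 2 ^+ n.+1 =
    (2 * Lam `^ (2 - 8 * alpha)) * N0 `^ (2 - 8 * alpha) *
    (2 * Lam `^ (2 - 8 * alpha)) ^+ n.
  by rewrite freq_powR// [in RHS]exprMn !exprS; ring.
have e7 : (N n.+1 `^ (1 - 4 * alpha) * v) ^+ 2 <=
    N n.+1 `^ (2 - 8 * alpha) * 2 ^+ n.+1 * V.
  rewrite exprMn powR_sqr -mulrA.
  have -> : 2 * (1 - 4 * alpha) = 2 - 8 * alpha by ring.
  rewrite ler_wpM2l ?powR_ge0//.
  by rewrite -ler_pdivrMl ?exprn_gt0// -exprVn.
(* The equation of mode [n.+1] multiplied by the weight and by [x n.+1]: inflow equals velocity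
   term, dissipation and outgoing flux. *)
have e8 : N n.+1 `^ (2 - 6 * alpha) * x n.+1 * (N n * x n ^+ 2) =
    (N n.+1 `^ (1 - 4 * alpha) * v) * a + nu * a ^+ 2 + flux x n.+1.
  rewrite -e2 /flux -e3 /v /rhs/=.
  rewrite [_ * (_ - _) * a]mulrAC.
  rewrite -e1; ring.
have e9 : N n.+1 `^ (2 - 6 * alpha) * x n.+1 * (N n * x n ^+ 2) <= flux x n.
  have -> : N n.+1 `^ (2 - 6 * alpha) * x n.+1 * (N n * x n ^+ 2) =
    N n.+1 `^ (2 - 6 * alpha) * N n * (x n ^+ 2 * x n.+1) by ring.
  by rewrite /flux -[leRHS]mulrA ler_wpM2r// mulr_ge0// sqr_ge0.
set y := N n.+1 `^ (1 - 4 * alpha) * v in e7 e8.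
(* Young's inequality: half of the dissipation absorbs the velocity term. *)
have e10 : - (y * a) <= nu / 2 * a ^+ 2 + y ^+ 2 / (2 * nu).
  have : 0 <= (nu * a + y) ^+ 2 / (2 * nu).
    by rewrite divr_ge0 ?sqr_ge0// mulr_ge0// ltW.
  have -> : (nu * a + y) ^+ 2 / (2 * nu) = nu / 2 * a ^+ 2 + y * a + y ^+ 2 / (2 * nu).
    by field; rewrite gt_eqF.
  lra.
have e11 : y ^+ 2 / (2 * nu) <=
    V * (2 * Lam `^ (2 - 8 * alpha)) * N0 `^ (2 - 8 * alpha) / (2 * nu) *
    (2 * Lam `^ (2 - 8 * alpha)) ^+ n.
  have -> : V * (2 * Lam `^ (2 - 8 * alpha)) * N0 `^ (2 - 8 * alpha) / (2 * nu) *
    (2 * Lam `^ (2 - 8 * alpha)) ^+ n =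
    N n.+1 `^ (2 - 8 * alpha) * 2 ^+ n.+1 * V / (2 * nu).
    by rewrite e6; ring.
  apply: ler_wpM2r e7.
  by rewrite invr_ge0 mulr_ge0// ltW.
lra.
Qed.

Lemma fluxE (x : nat -> R) n :
  flux x n =
  Lam `^ (2 * alpha - 1) * amplitude x n ^+ 2 * amplitude x n.+1.
Proof.
rewrite /flux /amplitude freq_powRS// exprMn powR_sqr.
have -> : N n `^ (3 - 6 * alpha) = N n `^ (2 * (1 - 2 * alpha)) * N n `^ (1 - 2 * alpha).
  by rewrite -freq_powRD//; congr (_ `^ _); lra.
have L1 : Lam `^ (2 * alpha - 1) * Lam `^ (1 - 2 * alpha) = 1.
  rewrite -powRD ?(gt_eqF Lam_gt0) ?implybT//.
  have -> : 2 * alpha - 1 + (1 - 2 * alpha) = 0 by ring.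
  exact: powRr0.
rewrite [RHS](_ : _ = (Lam `^ (2 * alpha - 1) * Lam `^ (1 - 2 * alpha)) *
  (N n `^ (2 * (1 - 2 * alpha)) * N n `^ (1 - 2 * alpha) * x n ^+ 2 * x n.+1)).
  by rewrite L1 mul1r.
ring.
Qed.

Lemma amplitude_bound V g0 : 0 <= V -> exists Q, 0 <= Q /\
  forall x : nat -> R, (forall n, 0 <= x n) ->
    flux x 0 <= g0 ->
    (forall n, 2^-1 ^+ n * rhs N lam x n ^+ 2 <= V \/ x n = 0) ->
    forall n, amplitude x n.+1 ^+ 2 * n.+1%:R <= Q.
Proof.
move=> V0.
pose r := 2 * Lam `^ (2 - 8 * alpha).
have r1 : r < 1 := ratio_lt1.
pose c := V * r * N0 `^ (2 - 8 * alpha) / (2 * nu).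
have r0 : 0 < r by rewrite mulr_gt0// powR_gt0.
have c0 : 0 <= c.
  by rewrite divr_ge0 ?mulr_ge0 ?powR_ge0// ltW.
have p0 : 0 < Lam `^ (2 * alpha - 1) by rewrite powR_gt0.
have r01 : 0 < r < 1 by rewrite r0.
have d0 : 0 < nu / 2 by rewrite divr_gt0.
have [Q [Q0 hQ]] := flux_decay g0 p0 r01 c0 d0.
exists Q; split=> // x x0 hg hx.
apply: (hQ (amplitude x) (flux x)).
- by move=> n; rewrite mulr_ge0// powR_ge0.
- by rewrite hg /flux !mulr_ge0 ?powR_ge0 ?exprn_ge0.
- move=> n; have [hv|xn] := hx n.+1; first exact: flux_step.
  rewrite /flux /amplitude xn !mulr0 !expr0n/= !(mulr0, mul0r) add0r.
  by rewrite add0r mulr_ge0// exprn_ge0// ltW.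
- exact: fluxE.
Qed.

End Decay.


(** * Bounds uniform in the truncation level *)

Section UniformBounds.
Context {R : realType}.
Variables N0 Lam nu alpha : R.
Hypothesis N0_gt0 : 0 < N0.
Hypothesis Lam_gt1 : 1 < Lam.
Hypothesis nu_gt0 : 0 < nu.
Hypothesis alpha_ge : 3^-1 <= alpha.
Hypothesis ratio_lt1 : 2 * Lam `^ (2 - 8 * alpha) < 1.
Local Notation N := (freq N0 Lam).
Local Notation lam := (damping N0 Lam nu alpha).
Variable h : nat -> R.
Hypothesis h_ge0 : forall n, 0 <= h n.
Hypothesis h_smooth : in_sobolev_infty N h.

Let Lam_gt0 : 0 < Lam. Proof. exact: lt_trans Lam_gt1. Qed.
Let N_gt0 n : 0 < N n. Proof. exact: freq_gt0. Qed.
Let N_ge0 n : 0 <= N n. Proof. exact: ltW. Qed.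
Let lam_gt0 n : 0 < lam n. Proof. exact: damping_gt0. Qed.

Let h_decay s : exists B, 0 <= B /\ forall n, N n `^ s * h n <= B.
Proof.
apply: rapid_decay_bound => // e e0.
have [B hB] := sobolev_infty_bounded e0 h_smooth.
by exists B => n; have := hB n; rewrite ger0_norm.
Qed.

Definition galerkin_datum K (u : R -> nat -> R) :=
  forall n, (n <= K)%N -> u 0 n = h n.

Lemma sum_half_le2 n : \sum_(k < n) 2^-1 ^+ k <= 2 :> R.
Proof.
suff -> : \sum_(k < n) 2^-1 ^+ k = 2 - 2 * 2^-1 ^+ n :> R.
  by rewrite gerBl mulr_ge0// exprn_ge0.
elim: n => [|n IH]; first by rewrite big_ord0 expr0; ring.
by rewrite big_ord_recr/= IH exprS; field.
Qed.

(** Serves both for the initial velocity ([W = h]) and for the uniform Lipschitz bound in time of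
    the truncations. *)
Lemma rhs_bounded (W : nat -> R) : (forall n, 0 <= W n) ->
  (forall s, exists B, 0 <= B /\ forall n, N n `^ s * W n <= B) ->
  exists D, 0 <= D /\ forall x : nat -> R, (forall n, 0 <= x n <= W n) ->
    forall n, `|rhs N lam x n| <= D.
Proof.
move=> W0 hW.
have [B1 [B10 hB1]] := hW 1.
have [B0 [B00 hB0]] := hW 0.
have [B2 [B20 hB2]] := hW (2 * alpha).
exists (B1 * B0 + nu * B2 + B1 * B0); split.
  by rewrite !addr_ge0// mulr_ge0// ltW.
move=> x hx n.
have x0 m : 0 <= x m by have /andP[] := hx m.
have xW m : x m <= W m by have /andP[] := hx m.
have xB m : x m <= B0.
  by apply: le_trans (xW m) _; have := hB0 m; rewrite powRr0 mul1r.
have Nx m : N m * x m <= B1.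
  apply: (@le_trans _ _ (N m * W m)); first by rewrite ler_wpM2l.
  by have := hB1 m; rewrite freq_powR1.
have Nxx m k : 0 <= N m * x m * x k <= B1 * B0.
  apply/andP; split; first exact/mulr_ge0/x0/mulr_ge0.
  by apply: ler_pM => //; exact: mulr_ge0.
have lx m : 0 <= lam m * x m <= nu * B2.
  apply/andP; split; first exact: mulr_ge0 (ltW (lam_gt0 m)) (x0 m).
  rewrite /damping -mulrA ler_wpM2l ?(ltW nu_gt0)//.
  by apply: le_trans (hB2 m); rewrite ler_wpM2l ?powR_ge0.
have i : 0 <= incoming N x n <= B1 * B0.
  case: (n) => [|m]/=; first by rewrite lexx mulr_ge0.
  by rewrite expr2 mulrA.
have := Nxx n n.+1; have := lx n; rewrite /rhs ler_norml; lra.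
Qed.

Lemma galerkin_velocity : exists V, 0 <= V /\
  forall K u, galerkin_solution N lam K u -> galerkin_datum K u ->
  forall t : R, 0 <= t -> forall n, (n <= K)%N ->
    2^-1 ^+ n * rhs N lam (u t) n ^+ 2 <= V.
Proof.
have [B [B_ge0 hB]] := rhs_bounded h_ge0 h_decay.
(* [B] bounds the initial velocity of every truncation, and the weights sum to at most [2]. *)
exists (2 * B ^+ 2); split; first by rewrite mulr_ge0// sqr_ge0.
move=> K u hu u0 t t0 n nK; have [_ uK u_ge0] := hu.
have u0_box m : 0 <= u 0 m <= h m.
  rewrite u_ge0//=.
  by have [/u0->//|/(uK 0 (lexx _))->] := leqP m K.
apply: (@le_trans _ _ (\sum_(k < K.+1) 2^-1 ^+ k * rhs N lam (u t) k ^+ 2)).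
  rewrite -ltnS in nK; rewrite (bigD1 (Ordinal nK))//= lerDl.
  apply: sumr_ge0 => i _; apply: mulr_ge0; last exact: sqr_ge0.
  exact: exprn_ge0.
apply: le_trans (galerkin_velocity_bound N_ge0 lam_gt0 hu t0) _.
apply: (@le_trans _ _ (\sum_(k < K.+1) 2^-1 ^+ k * B ^+ 2)).
  apply: ler_sum => i _; rewrite ler_wpM2l ?exprn_ge0//.
  rewrite -[rhs _ _ _ _ ^+ 2]real_normK ?num_real//.
  by rewrite lerXn2r ?nnegrE ?hB.
by rewrite -mulr_suml ler_wpM2r ?sqr_ge0// sum_half_le2.
Qed.

Let C := box N lam h.

(** Like [box], but one factor of the inflow is bounded through the amplitude,
    [N_m u_m^2 = N_m^(2 alpha) A_m u_m] with [A_m <= eps m]. The recursion becomes linear, with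
    small coefficients once [eps] is small. *)
Fixpoint majorant (eps : nat -> R) n : R :=
  if n is m.+1 then
    Num.max (h n) (N m `^ (2 * alpha) * eps m * majorant eps m / lam n)
  else h 0%N.

Lemma majorant_ge0 (eps : nat -> R) n : (forall k, 0 <= eps k) -> 0 <= majorant eps n.
Proof. by move=> e0; case: n => [|n]//=; rewrite le_max h_ge0. Qed.

Lemma majorant_decay (eps : nat -> R) s :
  (forall n, 0 <= eps n) -> eps n @[n --> \oo] --> 0 ->
  exists B, forall n, N n `^ s * majorant eps n <= B.
Proof.
move=> e0 ecvg.
have [H [H0 hH]] := h_decay s.
(* The weighted majorant is multiplied by at most [c * eps n] per step, and this tends to zero for
   every [s]. *)
pose c := Lam `^ s / (nu * Lam `^ (2 * alpha)).
have c0 : 0 < c by rewrite divr_gt0 ?mulr_gt0 ?powR_gt0.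
apply: (@eventually_contracting_bounded _ _ (fun n => c * eps n) H) => //.
- by move=> n; rewrite mulr_ge0 ?powR_ge0// majorant_ge0.
- move=> n /=; rewrite le_max.
  have [hm|hm] := leP (h n.+1)
    (N n `^ (2 * alpha) * eps n * majorant eps n / lam n.+1); last first.
    by rewrite hH.
  apply/orP; right.
  rewrite le_eqVlt; apply/orP; left; apply/eqP.
  rewrite /damping !freq_powRS// /c; field.
  by rewrite !gt_eqF ?powR_gt0// freq_powR_gt0.
- have : c * eps n @[n --> \oo] --> c * 0 by apply: cvgM => //; exact: cvg_cst.
  by rewrite mulr0 => H1; apply: (cvgr_le 0 H1); exact: ltr01.
Unshelve. all: by end_near. Qed.

Lemma galerkin_le_majorant (eps : nat -> R) K u : galerkin_solution N lam K u ->
  galerkin_datum K u ->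
  (forall t : R, 0 <= t -> forall n,
     amplitude N0 Lam alpha (u t) n <= eps n) ->
  forall t : R, 0 <= t -> forall n, u t n <= majorant eps n.
Proof.
move=> [hu uK u_ge0] u0 he.
have e0 n : 0 <= eps n.
  apply: le_trans (he 0 (lexx _) n).
  by rewrite mulr_ge0 ?powR_ge0// u_ge0.
move=> t t0 n; elim: n t t0 => [|n IH] t t0.
  have h0 s : 0 < s -> galerkin N lam K (u s) 0 <= - lam 0%N * u s 0%N + 0.
    move=> s0; rewrite /galerkin/= /rhs/=.
    have := mulr_ge0 (mulr_ge0 (N_ge0 0%N) (u_ge0 s (ltW s0) 0%N)) (u_ge0 s (ltW s0) 1%N).
    lra.
  have := evolves_le_max (lam_gt0 0%N) (hu 0%N) h0 t0.
  by rewrite mul0r u0// max_l.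
have [nK|nK] := leqP n.+1 K; last by rewrite uK// majorant_ge0.
have hb s : 0 < s -> galerkin N lam K (u s) n.+1 <=
    - lam n.+1 * u s n.+1 + N n `^ (2 * alpha) * eps n * majorant eps n.
  move=> s0; have s0' := ltW s0.
  rewrite /galerkin nK /rhs/=.
  have h1 := mulr_ge0 (mulr_ge0 (N_ge0 n.+1) (u_ge0 s s0' n.+1)) (u_ge0 s s0' n.+2).
  have -> : N n * u s n ^+ 2 =
      N n `^ (2 * alpha) * amplitude N0 Lam alpha (u s) n * u s n.
    rewrite /amplitude mulrA -freq_powRD//.
    have -> : 2 * alpha + (1 - 2 * alpha) = 1 by ring.
    by rewrite freq_powR1// expr2 mulrA.
  have h2 : N n `^ (2 * alpha) * amplitude N0 Lam alpha (u s) n * u s n <=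
      N n `^ (2 * alpha) * eps n * majorant eps n.
    apply: ler_pM; rewrite ?u_ge0 ?IH//.
      by rewrite !mulr_ge0 ?powR_ge0 ?u_ge0.
    by rewrite ler_wpM2l ?powR_ge0 ?he.
  lra.
have := evolves_le_max (lam_gt0 n.+1) (hu n.+1) hb t0.
by rewrite u0.
Qed.

Lemma galerkin_decay : exists W, [/\ forall n, 0 <= W n,
    forall s, exists B, forall n, N n `^ s * W n <= B
  & forall K u, galerkin_solution N lam K u -> galerkin_datum K u ->
    (forall t : R, 0 <= t -> forall n, u t n <= C n) ->
    forall t : R, 0 <= t -> forall n, u t n <= W n].
Proof.
have [V [V0 hV]] := galerkin_velocity.
(* The box bounds the flux out of mode [0] independently of [K]. *)
have [Q [Q0 hQ]] := amplitude_bound N0_gt0 Lam_gt1 nu_gt0 alpha_ge ratio_lt1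
  (N 0 `^ (3 - 6 * alpha) * C 0%N ^+ 2 * C 1%N) V0.
(* Mode [0] is bounded by the box: the amplitude bound starts at index [1], and [Q / 0] would take
   the default value [0]. *)
pose eps n := if n is 0 then N 0 `^ (1 - 2 * alpha) * C 0%N else Num.sqrt (Q / n%:R).
have C0 n : 0 <= C n by exact: box_ge0.
have e0 n : 0 <= eps n.
  by case: n => [|n]; [rewrite mulr_ge0 ?powR_ge0|exact: sqrtr_ge0].
have epsE n : (0 < n)%N -> eps n = Num.sqrt (Q / n%:R) by case: n.
exists (majorant eps); split=> [n|s|K u hu u0 uC].
- exact: majorant_ge0.
- apply: majorant_decay => //; apply/cvgrPdist_le => e epos; near=> n.
  rewrite sub0r normrN ger0_norm//.
  have n0 : (0 < n)%N by near: n; exact: nbhs_infty_gt.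
  rewrite epsE//.
  rewrite -[leRHS]ger0_norm ?(ltW epos)// -sqrtr_sqr ler_wsqrtr//.
  rewrite ler_pdivrMr ?ltr0n// mulrC -ler_pdivrMr ?exprn_gt0//.
  by near: n; exact: nbhs_infty_ger.
- apply: (galerkin_le_majorant hu u0) => t t0 n.
  have [_ uK u_ge0] := hu.
  case: n => [|n]; first by rewrite /amplitude ler_wpM2l ?powR_ge0 ?uC.
  rewrite /eps -[leLHS]ger0_norm; last by rewrite mulr_ge0 ?powR_ge0 ?u_ge0.
  rewrite -sqrtr_sqr ler_wsqrtr// ler_pdivlMr ?ltr0n//.
  apply: hQ; [exact: u_ge0| |move=> m].
  + rewrite /flux; apply: ler_pM; [|exact: u_ge0| |exact: uC].
      by apply: mulr_ge0; [exact: powR_ge0|exact: sqr_ge0].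
    apply: ler_wpM2l; first exact: powR_ge0.
    by rewrite lerXn2r ?nnegrE ?u_ge0 ?uC.
  + have [mK|mK] := leqP m K; [left; exact: hV mK|right; exact: uK].
Unshelve. all: by end_near. Qed.

End UniformBounds.


(** * Convergence of the truncations to a smooth solution *)

Section Existence.
Context {R : realType}.
Variables N0 Lam nu alpha : R.
Hypothesis N0_gt0 : 0 < N0.
Hypothesis Lam_gt1 : 1 < Lam.
Hypothesis nu_gt0 : 0 < nu.
Hypothesis alpha_ge : 3^-1 <= alpha.
Hypothesis ratio_lt1 : 2 * Lam `^ (2 - 8 * alpha) < 1.
Local Notation N := (freq N0 Lam).
Local Notation lam := (damping N0 Lam nu alpha).
Variable h : nat -> R.
Hypothesis h_ge0 : forall n, 0 <= h n.
Hypothesis h_smooth : in_sobolev_infty N h.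

Let N_gt0 n : 0 < N n. Proof. exact: freq_gt0. Qed.
Let N_ge0 n : 0 <= N n. Proof. exact: ltW. Qed.
Let lam_gt0 n : 0 < lam n. Proof. exact: damping_gt0. Qed.

(** Consecutive truncations are compared by [difference_bound], whose right side is [O(2^-K)] under
    the envelope [W]; each fixed mode therefore converges geometrically, and [evolves_lim] passes to
    the limit in the equation. *)
Lemma smooth_solution_exists : exists (u : R -> nat -> R) (W : nat -> R),
  [/\ forall s, exists B, 0 <= B /\ forall n, N n `^ s * W n <= B,
      forall t : R, 0 <= t -> forall n, 0 <= u t n <= W n,
      forall n, u 0 n = h n
    & forall n t, 0 <= t ->
        has_derivative_within (lifespan +oo) (fun t => u t n) t (rhs N lam (u t) n)].
Proof.
have [W [W0 Wd HW]] := galerkin_decay N0_gt0 Lam_gt1 nu_gt0 alpha_ge ratio_lt1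
  h_ge0 h_smooth.
have Wdec s : exists B, 0 <= B /\ forall n, N n `^ s * W n <= B.
  by apply: rapid_decay_bound => // e _; exact: Wd.
have /choice[U hU] : forall K, exists u, [/\ galerkin_solution N lam K u,
    galerkin_datum h K u & forall t : R, 0 <= t -> forall n, 0 <= u t n <= W n].
  move=> K; have [u [hu u0 ub]] := galerkin_exists N_ge0 lam_gt0 h_ge0 K.
  exists u; split=> // t t0 n; rewrite (HW _ _ hu u0)// andbT.
  by have [_ _ u_ge0] := hu; exact: u_ge0.
have U_ge0 K t : 0 <= t -> forall n, 0 <= U K t n.
  by move=> t0 n; have [_ _ /(_ t t0 n)/andP[]] := hU K.
have U_le K t : 0 <= t -> forall n, U K t n <= W n.
  by move=> t0 n; have [_ _ /(_ t t0 n)/andP[]] := hU K.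
have solves K m : (m <= K)%N -> solves_upto N lam m (U K).
  move=> mK n nm; have [[hu _ _] _ _] := hU K.
  apply: evolves_ext (hu n) => // t _.
  by rewrite /galerkin (leq_trans nm).
have [B0 [B00 hB0]] := Wdec 0.
have [B1 [B10 hB1]] := Wdec 1.
have W_le n : W n <= B0 by have := hB0 n; rewrite powRr0 mul1r.
have NW_le n : N n * W n <= B1 by have := hB1 n; rewrite freq_powR1.
pose B := 2 * (B1 * B0 * B0).
have cauchy n t k : 0 <= t -> (n <= k)%N ->
    (U k.+1 t n - U k t n) ^+ 2 <= 2 ^+ n * (2^-1 ^+ k * B * t).
  move=> t0 nk.
  have bd (x y : nat -> R) : (forall n, 0 <= x n <= W n) -> (forall n, 0 <= y n <= W n) ->
      N k * (x k ^+ 2 * y k.+1) <= B1 * B0 * B0.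
    move=> hx hy.
    have /andP[x0 xW] := hx k; have /andP[y0 yW] := hy k.+1.
    rewrite mulrA expr2 mulrA; apply: ler_pM => //.
    - by apply: mulr_ge0 => //; exact: mulr_ge0.
    - apply: ler_pM => //; [exact: mulr_ge0| |exact: le_trans xW (W_le _)].
      by apply: le_trans (NW_le k); rewrite ler_wpM2l.
    - exact: le_trans yW (W_le _).
  have Ub K s : 0 <= s -> forall n, 0 <= U K s n <= W n.
    by move=> s0 m; rewrite U_ge0// U_le.
  have H := @difference_bound _ N lam N_ge0 lam_gt0 k (U k.+1) (U k) B
    (solves _ _ (leqnSn k)) (solves _ _ (leqnn k)) (U_ge0 _) (U_ge0 _) _ _ t t0.
  have {}H : \sum_(n < k.+1) 2^-1 ^+ n * (U k.+1 t n - U k t n) ^+ 2 <= 2^-1 ^+ k * B * t.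
    apply: H => [m mk|s s0].
      have [_ d1 _] := hU k.+1; have [_ d2 _] := hU k.
      by rewrite d1 ?d2// leqW.
    rewrite mulrDr /B mulr2n mulrDl !mul1r; apply: lerD; apply: bd; exact: Ub.
  rewrite -ler_pdivrMl ?exprn_gt0// -exprVn; apply: le_trans H.
  rewrite -ltnS in nk; rewrite (bigD1 (Ordinal nk))//= lerDl.
  by apply: sumr_ge0 => i _; apply: mulr_ge0; [exact: exprn_ge0|exact: sqr_ge0].
have B_ge0 : 0 <= B by rewrite !mulr_ge0.
(* [cauchy] controls squares by [2^-1 ^+ k], so increments decay with ratio [q]. *)
pose q : R := Num.sqrt 2^-1.
have q0 : 0 <= q by exact: sqrtr_ge0.
have q2 : q ^+ 2 = 2^-1 by rewrite sqr_sqrtr// invr_ge0.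
have q01 : 0 <= q < 1.
  rewrite q0/=; have := q2; have : 2^-1 < 1 :> R by lra.
  by move=> h1 h2; rewrite ltNge; apply/negP => q1; nra.
(* The shift by [n] makes mode [n] active in every term, as [cauchy] and the equation of mode [n]
   require. *)
pose V K t n := U (K + n)%N t n.
have Vcvg t n : 0 <= t -> V k t n @[k --> \oo] --> limn (fun k => V k t n).
  move=> t0; pose c := 2 ^+ n * B * t.
  have c0 : 0 <= c by rewrite !mulr_ge0// exprn_ge0.
  apply: (@geometric_cvg _ (fun k => V k t n) (Num.sqrt c) q q01) => k.
  have e0 : 0 <= Num.sqrt c * q ^+ k by rewrite mulr_ge0 ?exprn_ge0 ?sqrtr_ge0.
  rewrite -[leRHS]ger0_norm// -ler_sqr ?nnegrE// !real_normK ?num_real//.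
  rewrite exprMn sqr_sqrtr// exprAC q2.
  apply: le_trans (cauchy n t (k + n)%N t0 (leq_addl _ _)) _.
  rewrite exprD; have : 2^-1 ^+ n <= 1 :> R by rewrite exprn_ile1//; lra.
  have r0 : 0 <= 2^-1 ^+ k * c by rewrite mulr_ge0 ?exprn_ge0.
  move=> h1; rewrite [leLHS](_ : _ = 2^-1 ^+ n * (2^-1 ^+ k * c)).
    by rewrite [leRHS]mulrC ler_piMl.
  by rewrite /c; ring.
pose u t n := limn (fun k => V k t n).
have {}Vcvg t n : 0 <= t -> V k t n @[k --> \oo] --> u t n := @Vcvg t n.
have Ucvg t n : 0 <= t -> U k t n @[k --> \oo] --> u t n.
  by move=> t0; have := Vcvg t n t0; rewrite (cvg_shiftn n (fun k => U k t n)).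
have [D [D0 hD]] := rhs_bounded alpha N0_gt0 Lam_gt1 nu_gt0 W0 Wdec.
have Ulip K s t n : 0 <= s -> 0 <= t -> `|U K s n - U K t n| <= D * `|s - t|.
  move=> s0 t0; have [[hu _ _] _ Ub] := hU K.
  apply: (evolves_lipschitz (hu n)) => // x x0; rewrite /galerkin.
  by case: ifP => _; [apply: hD; apply: Ub; exact: ltW|rewrite normr0].
exists u, W; split=> //.
- move=> t t0 n; apply/andP; split.
    by apply: (cvgr_to_ge (Ucvg t n t0)); near=> k; exact: U_ge0.
  by apply: (cvgr_to_le (Ucvg t n t0)); near=> k; exact: U_le.
- move=> n; rewrite /u; have -> : (fun k => V k 0 n) = cst (h n).
    by apply/funext => k; have [_ d _] := hU (k + n)%N; rewrite /V d// leq_addl.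
  exact: lim_cst.
- move=> n.
  apply: (@evolves_lim _ (fun k t => V k t n) (fun k t => rhs N lam (U (k + n)%N t) n)
    (fun t => u t n) (fun t => rhs N lam (u t) n) (linearized_norm N lam W n * D)).
  + by move=> k; apply: (solves _ n) => //; exact: leq_addl.
  + move=> k s t s0 t0; rewrite rhsB -mulrA.
    apply: linearized_le => // m.
      rewrite normrM (ger0_norm (_ : 0 <= 2^-1))// ger0_norm ?addr_ge0 ?U_ge0//.
      have := U_le (k + n)%N s s0 m; have := U_le (k + n)%N t t0 m; lra.
    exact: Ulip.
  + by move=> t t0; exact: Vcvg.
  + move=> t t0.
    have H : rhs N lam (U k t) n @[k --> \oo] --> rhs N lam (u t) n.
      by apply: rhs_cvg => m; exact: Ucvg.
    by have := H; rewrite -(cvg_shiftn n).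
Unshelve. all: by end_near. Qed.

End Existence.


(** * Norms of rapidly decaying sequences *)

Section Norms.
Context {R : realType}.

Lemma geometric_nneseries_le (a : nat -> R) (c q : R) : 0 <= q < 1 ->
  (forall n, 0 <= a n <= c * q ^+ n) ->
  (\sum_(0 <= n <oo) (a n)%:E <= (c / (1 - q))%:E)%E.
Proof.
move=> /andP[q0 q1] ha.
have q1' : 0 < 1 - q by rewrite subr_gt0.
have c0 : 0 <= c.
  by have /andP[a0 ac] := ha 0%N; rewrite (le_trans a0)// (le_trans ac)// expr0 mulr1.
apply: lime_le.
  by apply: is_cvg_nneseries => n _ _; rewrite lee_fin; have /andP[] := ha n.
near=> n; rewrite sumEFin lee_fin.
suff H : \sum_(0 <= i < n) a i <= c / (1 - q) - c / (1 - q) * q ^+ n.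
  apply: le_trans H _; rewrite gerBl mulr_ge0 ?exprn_ge0//.
  by rewrite divr_ge0// ltW.
elim: (n) => [|k IH]; first by rewrite big_geq// expr0 mulr1 subrr.
rewrite big_nat_recr//= exprS.
have /andP[_ ak] := ha k.
have -> : c / (1 - q) - c / (1 - q) * (q * q ^+ k) =
    c / (1 - q) - c / (1 - q) * q ^+ k + c * q ^+ k.
  by field; rewrite gt_eqF.
exact: lerD.
Unshelve. all: by end_near. Qed.

Lemma ell2_norm_sqE (N : nat -> R) (x : nat -> R) :
  ell2_norm_sq x = sobolev_norm_sq N 0 x.
Proof.
apply: eq_eseriesr => n _.
by rewrite mulr0 powRr0 mul1r real_normK ?num_real.
Qed.

Lemma coord_le_ell2 (x : nat -> R) n : ((x n ^+ 2)%:E <= ell2_norm_sq x)%E.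
Proof.
have t0 k : (0 <= (x k ^+ 2)%:E)%E by rewrite lee_fin sqr_ge0.
apply: le_trans (nneseries_lim_ge n.+1 _) => //.
by rewrite big_nat_recr//= leeDr// sume_ge0.
Qed.

Lemma sobolev_norm_sq_bound (N0 Lam : R) (W : nat -> R) s : 0 < N0 -> 1 < Lam ->
  (forall s, exists B, 0 <= B /\ forall n, freq N0 Lam n `^ s * W n <= B) ->
  exists S, forall x : nat -> R, (forall n, 0 <= x n <= W n) ->
    (sobolev_norm_sq (freq N0 Lam) s x <= S%:E)%E.
Proof.
(* One spare power of the frequency makes the terms of the series geometric. *)
move=> N00 Lam1 /(_ (s + 1)) [B [B0 hB]].
have L0 : 0 < Lam by exact: lt_trans Lam1.
pose c := (B / N0) ^+ 2; pose q := (Lam^-1) ^+ 2.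
have Li : 0 <= Lam^-1 < 1 by rewrite invr_ge0 (ltW L0)/= invf_lt1.
have /andP[Li0 Li1] := Li.
have q01 : 0 <= q < 1 by rewrite sqr_ge0/= /q expr_lt1.
exists (c / (1 - q)) => x hx; apply: geometric_nneseries_le => // n.
have /andP[x0 xW] := hx n.
rewrite mulr_ge0 ?powR_ge0 ?sqr_ge0//= -powR_sqr -exprMn ger0_norm//.
have cq0 : 0 <= B / N0 * Lam^-1 ^+ n.
  by apply: mulr_ge0; [apply: divr_ge0 => //; exact: ltW|exact: exprn_ge0].
rewrite /c /q exprAC -exprMn lerXn2r ?nnegrE//; first by rewrite mulr_ge0 ?powR_ge0.
have N0' := freq_gt0 N00 Lam1 n.
rewrite exprVn -mulrA -invfM -/(freq N0 Lam n) ler_pdivlMr//.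
apply: le_trans (hB n); rewrite freq_powRD// freq_powR1// mulrAC.
by rewrite ler_wpM2l// mulr_ge0 ?powR_ge0// ltW.
Qed.

End Norms.

(** * The energy inequality for non-negative solutions *)

Section Energy.
Context {R : realType}.
Variables N0 Lam nu alpha : R.
Hypothesis N0_gt0 : 0 < N0.
Hypothesis Lam_gt1 : 1 < Lam.
Hypothesis nu_gt0 : 0 < nu.
Local Notation N := (freq N0 Lam).
Local Notation lam := (damping N0 Lam nu alpha).

Lemma evolves_integral (F f : R -> R) (s t : R) : evolves F f ->
  {within `[0, +oo[, continuous f} -> 0 <= s -> s <= t ->
  (\int[lebesgue_measure]_(x in `[s, t]) (f x)%:E = (F t - F s)%:E)%E.
Proof.
move=> hF cf s0; rewrite le_eqVlt => /predU1P[<-|st].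
  by rewrite set_itv1 integral_set1 subrr.
have cF x : 0 < x -> {for x, continuous F}.
  move=> x0; apply/differentiable_continuous/derivable1_diffP.
  exact: evolves_derivable hF x0.
rewrite (continuous_FTC2 st (F := F)) //.
- apply: continuous_subspaceW cf => x/=.
  by rewrite !in_itv/= => /andP[/(le_trans s0)->].
- split.
  + move=> x; rewrite in_itv/= => /andP[sx _].
    exact: evolves_derivable hF (le_lt_trans s0 sx).
  + move: s0; rewrite le_eqVlt => /predU1P[<-|s0]; first exact: hF.2.
    exact/cvg_at_right_filter/cF.
  + exact/cvg_at_left_filter/cF/(le_lt_trans s0).
- move=> x; rewrite in_itv/= => /andP[sx _].
  exact: evolves_derive1 hF (le_lt_trans s0 sx).
Qed.

(** In a partial sum of the energy balance the nonlinearity contributes only the outgoing flux,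
    which non-negativity makes a loss; then the number of modes tends to infinity. *)
Lemma smooth_energy_inequality (u : R -> nat -> R) :
  (forall n, evolves (fun t => u t n) (fun t => rhs N lam (u t) n)) ->
  (forall t : R, 0 <= t -> forall n, 0 <= u t n) ->
  forall s t, 0 <= s -> s <= t -> energy_inequality N nu alpha u s t.
Proof.
move=> hu u0 s t s0 st; rewrite /energy_inequality /sobolev_norm_sq.
have t0 : 0 <= t := le_trans s0 st.
pose f n x := N n `^ (2 * alpha) * `|u x n| ^+ 2.
have f0 n x : 0 <= f n x by rewrite mulr_ge0 ?powR_ge0 ?sqr_ge0.
have fE n : f n = (fun x => N n `^ (2 * alpha) * (u x n * u x n)).
  by apply/funext => x; rewrite /f real_normK ?num_real// expr2.
have cf n : {within `[0, +oo[, continuous (f n)}.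
  rewrite fE; apply: (evolves_within (df := fun x => N n `^ (2 * alpha) *
    (rhs N lam (u x) n * u x n + u x n * rhs N lam (u x) n))).
  by apply/evolvesZ/evolvesM; exact: hu.
(* Primitives of the dissipation densities put energy and dissipation into one monotone quantity,
   free of integrals. *)
have /choice[P hP] n : exists P, evolves P (f n).
  by have [P [_ hP]] := evolves_primitive 0 (cf n); exists P.
have intE n : (\int[lebesgue_measure]_(x in `[s, t]) (f n x)%:E =
    (P n t - P n s)%:E)%E by exact: evolves_integral (hP n) (cf n) s0 st.
have dP0 n : 0 <= P n t - P n s.
  by rewrite -lee_fin -intE; apply: integral_ge0 => x _; rewrite lee_fin.
have -> : (\int[lebesgue_measure]_(x in `[s, t])
    \sum_(0 <= n <oo) (N n `^ (2 * alpha) * `|u x n| ^+ 2)%:E =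
    \sum_(0 <= n <oo) (P n t - P n s)%:E)%E.
  rewrite integral_nneseries//.
  - by apply: eq_eseriesr => n _; exact: intE.
  - move=> n; apply: (measurable_int lebesgue_measure).
    apply: (@continuous_compact_integrable _ (f n)); first exact: segment_compact.
    apply: continuous_subspaceW (cf n) => x/=.
    by rewrite !in_itv/= => /andP[/(le_trans s0)->].
  - by move=> n x _; rewrite lee_fin f0.
have nu0 : 0 <= 2 * nu by rewrite mulr_ge0// ltW.
rewrite -nneseriesZl; last by move=> n _; rewrite lee_fin.
rewrite /ell2_norm_sq -nneseriesD; last first.
- by move=> n _ _; rewrite -EFinM lee_fin mulr_ge0.
- by move=> n _ _; rewrite lee_fin sqr_ge0.
have s2 n : (0 <= (u s n ^+ 2)%:E)%E by rewrite lee_fin sqr_ge0.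
apply: lime_le.
  apply: is_cvg_nneseries => n _ _.
  by rewrite -EFinM -EFinD lee_fin addr_ge0 ?sqr_ge0// mulr_ge0.
near=> K; apply: le_trans (nneseries_lim_ge K _) => //.
under eq_bigr do rewrite -EFinM -EFinD.
rewrite !sumEFin lee_fin !big_mkord.
case: (K) => [|k]; first by rewrite !big_ord0.
have sq n : evolves (fun x => u x n ^+ 2) (fun x => 2 * (u x n * rhs N lam (u x) n)).
  by apply: evolves_ext (evolvesM (hu n) (hu n)) => x *; ring.
have H : evolves (fun x => \sum_(n < k.+1) (u x n ^+ 2 + 2 * nu * P n x))
    (fun x => \sum_(n < k.+1) (2 * (u x n * rhs N lam (u x) n) + 2 * nu * f n x)).
  apply: (@evolves_sum _ k.+1 (fun n x => u x n ^+ 2 + 2 * nu * P n x)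
    (fun n x => 2 * (u x n * rhs N lam (u x) n) + 2 * nu * f n x)) => n _.
  by apply: evolvesD => //; exact/evolvesZ.
have := evolves_nonincreasing H _ s0 st.
rewrite !big_split/= -!mulr_sumr => E.
have : \sum_(i < k.+1) u t i ^+ 2 + 2 * nu * \sum_(i < k.+1) P i t <=
  \sum_(i < k.+1) u s i ^+ 2 + 2 * nu * \sum_(i < k.+1) P i s.
  apply: E => x x0; have x0' := ltW x0.
  rewrite big_split/= -!mulr_sumr rhs_energy.
  have -> : \sum_(i < k.+1) lam i * u x i ^+ 2 = nu * \sum_(i < k.+1) f i x.
    rewrite mulr_sumr; apply: eq_bigr => i _.
    by rewrite /f /damping real_normK ?num_real// mulrA.
  have := mulr_ge0 (mulr_ge0 (ltW (freq_gt0 N0_gt0 Lam_gt1 k))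
    (sqr_ge0 (u x k))) (u0 x x0' k.+1).
  lra.
rewrite big_split/= sumrN; lra.
Unshelve. all: by end_near. Qed.

End Energy.


(** * Weak-strong uniqueness *)

Section Uniqueness.
Context {R : realType}.
Variables N0 Lam nu alpha : R.
Hypothesis N0_gt0 : 0 < N0.
Hypothesis Lam_gt1 : 1 < Lam.
Hypothesis nu_gt0 : 0 < nu.
Local Notation N := (freq N0 Lam).
Local Notation lam := (damping N0 Lam nu alpha).

Let N_gt0 n : 0 < N n. Proof. exact: freq_gt0. Qed.
Let N_ge0 n : 0 <= N n. Proof. exact: ltW. Qed.
Let lam_gt0 n : 0 < lam n. Proof. exact: damping_gt0. Qed.

Lemma finite_energy_evolves (h : nat -> R) (v : R -> nat -> R) :
  finite_energy_solution N nu alpha h (lifespan +oo) v ->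
  forall n, evolves (fun t => v t n) (fun t => rhs N lam (v t) n).
Proof.
move=> [_ hv _] n; have [dv [hdv _] hE] := hv n.
apply: evolves_ext (has_derivative_within_evolves hdv) => // t t0.
have := hE t; rewrite lifespany => /(_ (ltW t0)).
by rewrite /rhs /damping => E; lra.
Qed.

(* The regularity of [u] alone makes the boundary term of [difference_bound]
   negligible; of [v] only the boundedness in [l^2] is used. *)
Lemma nonneg_solution_unique (h W : nat -> R) (u v : R -> nat -> R) :
  (forall s, exists B, 0 <= B /\ forall n, N n `^ s * W n <= B) ->
  (forall t : R, 0 <= t -> forall n, 0 <= u t n <= W n) ->
  (forall n, evolves (fun t => u t n) (fun t => rhs N lam (u t) n)) ->
  (forall n, u 0 n = h n) ->
  leray_hopf_solution N nu alpha h +oo v -> nonneg_on (lifespan +oo) v ->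
  forall t : R, 0 <= t -> forall n, v t n = u t n.
Proof.
move=> Wdec ub hu uh [hfe hen _]; rewrite /nonneg_on lifespany => v0 t t0 n.
have hv := finite_energy_evolves hfe.
have [hell _ h0] := hfe.
have y0 : lifespan +oo (0 : R) by rewrite lifespany/=.
(* The energy inequality from time [0] bounds every coordinate of [v] uniformly in time. *)
have [M [M0 hM]] : exists M, 0 <= M /\ forall t, 0 <= t -> forall n, v t n <= M.
  have fin0 : (ell2_norm_sq (v 0)) \is a fin_num.
    rewrite ge0_fin_numE; first exact: hell.
    by apply: nneseries_ge0 => k _ _; rewrite lee_fin sqr_ge0.
  exists (1 + fine (ell2_norm_sq (v 0))); split.
    rewrite addr_ge0// fine_ge0//.
    by apply: nneseries_ge0 => k _ _; rewrite lee_fin sqr_ge0.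
  move=> s s0 k.
  have : ((v s k ^+ 2)%:E <= (fine (ell2_norm_sq (v 0)))%:E)%E.
    rewrite fineK//; apply: le_trans (hen s _); last by rewrite lifespany.
    apply: le_trans (coord_le_ell2 _ k) _; rewrite leeDl// mule_ge0//.
      by rewrite lee_fin mulr_ge0// ltW.
    apply: integral_ge0 => x _; apply: nneseries_ge0 => m _ _.
    by rewrite lee_fin mulr_ge0 ?powR_ge0 ?sqr_ge0.
  rewrite lee_fin; have := v0 s s0 k; nra.
have [B1 [B10 hB1]] := Wdec 1.
have [B0 [B00 hB0]] := Wdec 0.
have u0 s : 0 <= s -> forall k, 0 <= u s k by move=> s0 k; have /andP[] := ub s s0 k.
have uW s : 0 <= s -> forall k, u s k <= W k by move=> s0 k; have /andP[] := ub s s0 k.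
have uB s k : 0 <= s -> u s k <= B0.
  by move=> s0; apply: le_trans (uW s s0 k) _; have := hB0 k; rewrite powRr0 mul1r.
have Nu s k : 0 <= s -> N k * u s k <= B1.
  move=> s0; apply: (@le_trans _ _ (N k * W k)); first by rewrite ler_wpM2l ?uW.
  by have := hB1 k; rewrite freq_powR1.
(* In the second mixed product [N k] multiplies [u s k.+1], so it is replaced by [N k.+1] before the
   decay of [u] is used. *)
have NS k : N k <= N k.+1.
  rewrite /freq exprS mulrCA ler_peMl ?(ltW Lam_gt1)//; exact: (N_ge0 k).
pose B := B1 * B0 * M + M ^+ 2 * B1.
have bd K : (n <= K)%N -> (u t n - v t n) ^+ 2 <= 2 ^+ n * (2^-1 ^+ K * B * t).
  move=> nK.
  have H : \sum_(k < K.+1) 2^-1 ^+ k * (u t k - v t k) ^+ 2 <= 2^-1 ^+ K * B * t.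
    apply: (difference_bound N_ge0 lam_gt0 (fun k _ => hu k) (fun k _ => hv k)) => //.
    - by move=> k _; rewrite uh h0.
    - move=> s s0; rewrite mulrDr /B; apply: lerD.
        rewrite mulrA expr2 mulrA; apply: ler_pM.
        + apply: mulr_ge0; [apply: mulr_ge0 => //|]; exact: u0.
        + exact: v0.
        + apply: ler_pM; [|exact: u0|exact: Nu|exact: uB].
          by apply: mulr_ge0 => //; exact: u0.
        + exact: hM.
      rewrite mulrCA; apply: ler_pM.
      + exact: sqr_ge0.
      + by apply: mulr_ge0 => //; exact: u0.
      + by rewrite lerXn2r ?nnegrE ?hM ?v0.
      + by apply: le_trans (Nu s K.+1 s0); rewrite ler_wpM2r ?u0.
  rewrite -ler_pdivrMl ?exprn_gt0// -exprVn; apply: le_trans H.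
  rewrite -ltnS in nK; rewrite (bigD1 (Ordinal nK))//= lerDl.
  by apply: sumr_ge0 => i _; apply: mulr_ge0; [exact: exprn_ge0|exact: sqr_ge0].
(* Mode [n] stays fixed while the cutoff [K] tends to infinity, so the weight [2 ^+ n] is
   harmless. *)
have cv : 2 ^+ n * (2^-1 ^+ K * B * t) @[K --> \oo] --> 2 ^+ n * (0 * B * t).
  apply: cvgM; first exact: cvg_cst.
  apply: cvgM; last exact: cvg_cst.
  apply: cvgM; last exact: cvg_cst.
  by apply: cvg_expr; rewrite ger0_norm; lra.
have : (u t n - v t n) ^+ 2 <= 2 ^+ n * (0 * B * t).
  apply: (cvgr_to_ge cv); near=> K; apply: bd; near: K; exact: nbhs_infty_ge.
rewrite !mul0r mulr0 => le0.
have : (u t n - v t n) ^+ 2 == 0 by rewrite eq_le le0 sqr_ge0.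
by rewrite sqrf_eq0 subr_eq0 => /eqP.
Unshelve. all: by end_near. Qed.

End Uniqueness.

(** * Assembly of the well-posedness statement and the threshold for [alpha] *)

Section WellPosedness.
Context {R : realType}.
Variables N0 Lam nu alpha : R.
Hypothesis N0_gt0 : 0 < N0.
Hypothesis Lam_gt1 : 1 < Lam.
Hypothesis nu_gt0 : 0 < nu.

Lemma smooth_and_unique_subcritical : 3^-1 <= alpha ->
  2 * Lam `^ (2 - 8 * alpha) < 1 -> smooth_and_unique (freq N0 Lam) nu alpha.
Proof.
move=> alpha_ge ratio_lt1 h h0 hs.
have [u [W [Wdec ub uh hu]]] := smooth_solution_exists N0_gt0 Lam_gt1 nu_gt0
  alpha_ge ratio_lt1 h0 hs.
have hev n : evolves (fun t => u t n)
    (fun t => rhs (freq N0 Lam) (damping N0 Lam nu alpha) (u t) n).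
  apply: has_derivative_within_evolves => t; rewrite {1}lifespany; exact: hu.
have u0 t : 0 <= t -> forall n, 0 <= u t n by move=> t0 n; have /andP[] := ub t t0 n.
have fe : finite_energy_solution (freq N0 Lam) nu alpha h (lifespan +oo) u.
  split=> // [t|n].
    rewrite lifespany => t0.
    have [S hS] := sobolev_norm_sq_bound 0 N0_gt0 Lam_gt1 Wdec.
    by rewrite (ell2_norm_sqE (freq N0 Lam)) (le_lt_trans (hS _ (ub t t0))) ?ltry.
  exists (fun t => rhs (freq N0 Lam) (damping N0 Lam nu alpha) (u t) n).
    split; first by move=> t; rewrite {1}lifespany; exact: hu.
    have -> : lifespan +oo = `[(0 : R), +oo[%classic.
      by rewrite lifespany; apply/seteqP; split=> t /=; rewrite in_itv/= andbT.
    exact: evolves_within (evolves_rhs _ _ _ hev).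
  by move=> t _; rewrite /rhs /damping; ring.
have en s t : 0 <= s -> s <= t -> energy_inequality (freq N0 Lam) nu alpha u s t.
  exact: smooth_energy_inequality.
exists u; split=> //.
- move=> s T s0 T0.
  have [S hS] := sobolev_norm_sq_bound s N0_gt0 Lam_gt1 Wdec.
  have S0 x : (0 <= sobolev_norm_sq (freq N0 Lam) s x)%E.
    by apply: nneseries_ge0 => n _ _; rewrite lee_fin mulr_ge0 ?powR_ge0 ?sqr_ge0.
  apply: (@le_lt_trans _ _ ((S `^ 2^-1)%:E)); last exact: ltry.
  apply: ge_ereal_sup => _ [t + <-]; rewrite /= in_itv/= => /andP[t0 _].
  have hSt := hS _ (ub t t0).
  rewrite -poweR_EFin; apply: gt0_ler_poweR => //.
  + by rewrite in_itv/= S0 leey.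
  + by rewrite in_itv/= (le_trans (S0 _) hSt) leey.
- split=> //.
  + by move=> t; rewrite lifespany => t0; exact: en.
  + by apply: aeW => t0 t00 _ t t0t _; apply: en => //; exact: ltW.
- by move=> t; rewrite lifespany; exact: u0.
- move=> v hv v0 t; rewrite lifespany => t0 n.
  exact: (nonneg_solution_unique N0_gt0 Lam_gt1 nu_gt0 Wdec ub hev uh hv v0).
Qed.

End WellPosedness.

Theorem theorem1p2 (R : realType) (N0 Lam nu : R)
    (hN0 : 0 < N0) (hLam : 1 < Lam) (hnu : 0 < nu) :
  (forall alpha : R, 3^-1 <= alpha ->
     ln 2 / (2 * ln Lam) < 4 * alpha - 1 ->
     smooth_and_unique (freq N0 Lam) nu alpha) /\
  (2 `^ (3 / 2) < Lam ->
     forall alpha : R, 3^-1 <= alpha ->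
     smooth_and_unique (freq N0 Lam) nu alpha).
Proof.
have lnLam : 0 < ln Lam by rewrite ln_gt0.
have Lam0 : 0 < Lam := lt_trans ltr01 hLam.
have main : forall alpha : R, 3^-1 <= alpha ->
    ln 2 / (2 * ln Lam) < 4 * alpha - 1 ->
    smooth_and_unique (freq N0 Lam) nu alpha.
  move=> alpha ha; rewrite ltr_pdivrMr ?mulr_gt0// => hlt.
  apply: smooth_and_unique_subcritical => //.
  (* Taking logarithms turns [ratio_lt1] into the hypothesis on [4 * alpha - 1]. *)
  rewrite -ltr_ln ?posrE ?mulr_gt0 ?powR_gt0// lnM ?posrE ?powR_gt0//.
  rewrite ln_powR ln1; lra.
split=> // h32 alpha ha; apply: main => //.
(* For such [Lam] the threshold lies below [1/3], while [alpha >= 1/3] gives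
   [4 * alpha - 1 >= 1/3]. *)
have : ln (2 `^ (3 / 2)) < ln Lam by rewrite ltr_ln ?posrE ?powR_gt0.
rewrite ln_powR => hl; rewrite ltr_pdivrMr ?mulr_gt0//.
have ha' : 1 <= 3 * alpha by rewrite -ler_pdivrMl// mulr1.
have := ler_wpM2r (ltW lnLam) ha'; lra.
Qed.
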